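(* Let $M$ be a manifold and let $F$ be a bounded Filippov system on $M$. Then $(\widetilde M,\widetilde d)$ is a metric space and $\widetilde\Phi$ is a continuous flow on $\widetilde M$.
   Context: Setting. $M$ is a manifold (possibly with boundary) with a Riemannian metric and induced distance $d$. There is a $C^r$ function $h:M\to\mathbb R$ ($r>1$ large enough) with $0$ as a regular value such that $\Sigma=h^{-1}(0)$ is a compact embedded codimension $1$ submanifold (the switching manifold); put $M_+=\{h>0\}$, $M_-=\{h<0\}$. A piecewise smooth vector field (Filippov system) $F=(F_+,F_-)$ is given by two $C^r$ vector fields $F_+,F_-$ on $M$, via $F(p)=\frac{F_+(p)+F_-(p)}2+\mathrm{sgn}(h(p))\frac{F_+(p)-F_-(p)}2$, where $\mathrm{sgn}$ is multivalued at $0$ with values in $[-1,1]$; so $F=F_\pm$ on $M_\pm$. $\|F\|$ denotes the supremum norm; $F$ is bounded if $\|F\|<\infty$ (equivalently $F_+$ and $F_-$ are bounded). It is assumed that $\|F\|>0$. Regions. For a vector field $X$, $Xh(p)=\langle\nabla h(p),X(p)\rangle_p$. The tangent, crossing and sliding regions are $\Sigma^t=\{p\in\Sigma: F_+h(p)F_-h(p)=0\}$, $\Sigma^c=\{p\in\Sigma: F_+h(p)F_-h(p)>0\}$, $\Sigma^s=\{p\in\Sigma: F_+h(p)F_-h(p)<0\}$. The sliding vector field on $\Sigma^s$ is $F_s(p)=\frac{F_-h(p)F_+(p)-F_+h(p)F_-(p)}{F_-h(p)-F_+h(p)}$. Filippov orbits. A Filippov solution (orbit) of $F$ is a continuous,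 piecewise smooth curve in $M$ whose smooth pieces are integral trajectories of $F_+$ (in $M_+$), of $F_-$ (in $M_-$) or of $F_s$ (in $\Sigma^s$, including its extension to points of $\Sigma^t$ when possible), the pieces being glued to each other at points of $\Sigma$: at points of $\Sigma^c$ by concatenating trajectories of $F_+$ in $M_+$ and $F_-$ in $M_-$, and at points of $\Sigma^s\cup\Sigma^t$ by any such concatenation. An orbit is maximal if its interval of definition cannot be enlarged. Standing assumption: maximal orbits are defined for all $t\in\mathbb R$. Orbit space. $\widetilde M$ is the set of all maximal orbits of $F$. The flow is $\widetilde\Phi^t:\widetilde M\to\widetilde M$, $\widetilde\Phi^t(\gamma)(s)=\gamma(t+s)$ for $s,t\in\mathbb R$. The integral distance is $$\widetilde d(\gamma_0,\gamma_1)=\sum_{i\in\mathbb Z}\frac1{2^{|i|}}\int_i^{i+1}d(\gamma_0(t),\gamma_1(t))\,dt .$$ The claim that $(\widetilde M,\widetilde d)$ is a metric space includes that this sum is always finite. Continuity of $\widetilde\Phi$ means continuity of $\mathbb R\times\widetilde M\to\widetilde M$, $(t,\gamma)\mapsto\widetilde\Phi^t(\gamma)$.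
   Formalization: M is assumed connected; otherwise the induced distance d between points of different components is infinite, so the integral distance of orbits in different components is infinite and the orbit space is not a metric space. *)

(* Defs.v *)
From HB Require Import structures.
From mathcomp Require Import all_boot all_order all_algebra.
From mathcomp Require Import all_classical all_reals all_analysis.
Set Implicit Arguments.
Unset Strict Implicit.
Unset Printing Implicit Defensive.
Import Order.TTheory GRing.Theory Num.Theory.
Import numFieldNormedType.Exports.
Local Open Scope classical_set_scope.
Local Open Scope ring_scope.

(* L is a derivative at x of f restricted to S.  When S is relatively open in a
   half-space, or is a nondegenerate interval, L is unique. *)
Definition has_diff_within (R : realType) (V W : normedModType R)
    (S : set V) (f : V -> W) (x : V) (L : V -> W) : Prop :=
  linear L /\
  forall e : R, 0 < e ->
    \forall y \near within S (nbhs x), `|f y - f x - L (y - x)| <= e * `|y - x|.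

(* Class C^k on S, by successive (one-sided, at boundary points) directional
   derivatives; used only for finite-dimensional V and for S as above. *)
Fixpoint Ck (R : realType) (k : nat) (V W : normedModType R)
    (S : set V) (f : V -> W) : Prop :=
  {within S, continuous f} /\
  match k with
  | 0 => True
  | k'.+1 => exists Df : V -> V -> W,
      (forall x, S x -> has_diff_within S f x (Df x)) /\
      (forall v, Ck k' S (fun x => Df x v))
  end.

Definition smooth (R : realType) (V W : normedModType R)
    (S : set V) (f : V -> W) : Prop := forall k, Ck k S f.

(* {x_0 >= 0}; everything when n = 0. *)
Definition half_space (R : realType) (n : nat) : set 'rV[R]_n :=
  [set x | forall i : 'I_n, val i = 0%N -> 0 <= x ord0 i].

Definition half_space_open (R : realType) (n : nat) (U : set 'rV[R]_n) : Prop :=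
  exists2 V : set 'rV[R]_n, open V & U = V `&` @half_space R n.

(* Smooth n-manifolds with (possibly empty) boundary.  [chart_at] merely selects
   a chart around each point. *)
Record manifold (R : realType) (n : nat) := Manifold {
  carrier :> topologicalType;
  manifold_hausdorff : hausdorff_space carrier;
  manifold_second_countable : @second_countable carrier;
  chart : Type;
  dom : chart -> set carrier;
  phi : chart -> carrier -> 'rV[R]_n;
  psi : chart -> 'rV[R]_n -> carrier;
  chart_at : carrier -> chart;
  dom_chart_at : forall p, dom (chart_at p) p;
  dom_open : forall c, open (dom c);
  phi_open : forall c, half_space_open (phi c @` dom c);
  phiK : forall c, {in dom c, cancel (phi c) (psi c)};
  phi_continuous : forall c, {within dom c, continuous (phi c)};
  psi_continuous : forall c, {within phi c @` dom c, continuous (psi c)};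
  transition_smooth : forall c c',
    smooth (phi c @` (dom c `&` dom c')) (phi c' \o psi c)
}.

Definition is_transition_diff (R : realType) (n : nat) (M : manifold R n)
    (c c' : chart M) (p : M) (L : 'rV[R]_n -> 'rV[R]_n) : Prop :=
  has_diff_within (phi c @` (dom c `&` dom c')) (phi c' \o psi c) (phi c p) L.

(* [vf c p] is the component vector at p in the chart c, meaningful for p in
   [dom c]; tangent vectors at p are handled through such components. *)
Record vector_field (R : realType) (n : nat) (M : manifold R n) (r : nat) :=
  VectorField {
  vf :> chart M -> M -> 'rV[R]_n;
  vf_compat : forall c c' p L, dom c p -> dom c' p ->
    is_transition_diff c c' p L -> vf c' p = L (vf c p);
  vf_Cr : forall c, Ck r (phi c @` dom c) (fun x => vf c (psi c x))
}.

Definition bilin (R : realType) (n : nat) (A : 'M[R]_n) (u v : 'rV[R]_n) : R :=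
  (u *m A *m v^T) 0 0.

Record riemannian_metric (R : realType) (n : nat) (M : manifold R n) :=
  RiemannianMetric {
  gram :> chart M -> M -> 'M[R]_n;
  gram_sym : forall c p, dom c p -> (gram c p)^T = gram c p;
  gram_pos : forall c p u, dom c p -> u != 0 -> 0 < bilin (gram c p) u u;
  gram_compat : forall c c' p L, dom c p -> dom c' p ->
    is_transition_diff c c' p L ->
    forall u v, bilin (gram c' p) (L u) (L v) = bilin (gram c p) u v;
  gram_smooth : forall c, smooth (phi c @` dom c) (fun x => gram c (psi c x))
}.

(* Inner product and norm on T_pM, in the components given by [chart_at p]. *)
Definition inner (R : realType) (n : nat) (M : manifold R n)
    (G : riemannian_metric M) (p : M) (u v : 'rV[R]_n) : R :=
  bilin (G (chart_at p) p) u v.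

Definition tnorm (R : realType) (n : nat) (M : manifold R n)
    (G : riemannian_metric M) (p : M) (v : 'rV[R]_n) : R :=
  Num.sqrt (inner G p v v).

Definition C1_curve (R : realType) (n : nat) (M : manifold R n)
    (a b : R) (s : R -> M) : Prop :=
  {within `[a, b], continuous s} /\
  forall c : chart M,
    @Ck R 1 R^o _ (`[a, b] `&` s @^-1` dom c) (phi c \o s).

Definition piecewise_C1 (R : realType) (n : nat) (M : manifold R n)
    (s : R -> M) : Prop :=
  exists B : seq R, forall a b, 0 <= a -> a < b -> b <= 1 ->
    (forall t, t \in B -> ~~ (a < t < b)) -> C1_curve a b s.

Definition speed (R : realType) (n : nat) (M : manifold R n)
    (G : riemannian_metric M) (s : R -> M) (t : R) : R :=
  tnorm G (s t) (@derive1 R 'rV[R]_n (phi (chart_at (s t)) \o s) t).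

Definition curve_length (R : realType) (n : nat) (M : manifold R n)
    (G : riemannian_metric M) (s : R -> M) : \bar R :=
  (\int[lebesgue_measure]_(t in `[0%R, 1%R]) (speed G s t)%:E)%E.

Definition rdist (R : realType) (n : nat) (M : manifold R n)
    (G : riemannian_metric M) (p q : M) : \bar R :=
  ereal_inf [set curve_length G s | s in
    [set s : R -> M | [/\ piecewise_C1 s, s 0 = p & s 1 = q]]].

Definition Cr_function (R : realType) (n : nat) (M : manifold R n) (r : nat)
    (h : M -> R) : Prop :=
  forall c : chart M, @Ck R r _ R^o (phi c @` dom c) (h \o psi c).

Definition is_differential (R : realType) (n : nat) (M : manifold R n)
    (h : M -> R) (p : M) (L : 'rV[R]_n -> R) : Prop :=
  let c := chart_at p in
  @has_diff_within R _ R^o (phi c @` dom c) (h \o psi c) (phi c p) L.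

Definition gradient (R : realType) (n : nat) (M : manifold R n)
    (G : riemannian_metric M) (h : M -> R) (p : M) : 'rV[R]_n :=
  xget 0 [set w | is_differential h p (inner G p w)].

Definition regular_value (R : realType) (n : nat) (M : manifold R n)
    (h : M -> R) (a : R) : Prop :=
  forall p L, h p = a -> is_differential h p L -> forall y, exists v, L v = y.

(* C^r embedded submanifold of dimension m (possibly with boundary): around each
   point, S is the homeomorphic image of a C^r immersion of a relatively open
   subset of an m-dimensional half-space. *)
Definition embedded_submanifold (R : realType) (n : nat) (M : manifold R n)
    (r m : nat) (S : set M) : Prop :=
  forall p, S p -> exists (U : set M) (V : set 'rV[R]_m)
      (f : 'rV[R]_m -> M) (g : M -> 'rV[R]_m),
    let c := chart_at p in
    [/\ [/\ open U, U p & U `<=` dom c],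
        [/\ half_space_open V, f @` V = S `&` U & {in V, cancel f g}],
        {within V, continuous f} /\ {within S `&` U, continuous g},
        Ck r V (phi c \o f) &
        forall x L, V x -> has_diff_within V (phi c \o f) x L -> injective L].

(* The dimension is n.+1, the switching manifold {h = 0} having codimension 1. *)
Record filippov_system (R : realType) (n : nat) (M : manifold R n.+1)
    (r : nat) := FilippovSystem {
  hfun : M -> R;
  hfun_Cr : Cr_function r hfun;
  hfun_regular : regular_value hfun 0;
  hfun_compact : compact [set p | hfun p = 0];
  hfun_embedded : embedded_submanifold r n [set p | hfun p = 0];
  Fplus : vector_field M r;
  Fminus : vector_field M r
}.

Section Filippov.
Context (R : realType) (n : nat) (M : manifold R n.+1).
Context (G : riemannian_metric M) (r : nat) (F : filippov_system M r).

Let h : M -> R := hfun F.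

Definition Sigma : set M := [set p | h p = 0].
Definition Mplus : set M := [set p | 0 < h p].
Definition Mminus : set M := [set p | h p < 0].

Definition sgn_multi (x : R) : set R :=
  [set s | if x == 0 then -1 <= s <= 1 else s == Num.sg x].

(* The (multivalued) F(p), in the components given by [chart_at p]. *)
Definition Fval (p : M) : set 'rV[R]_n.+1 :=
  let c := chart_at p in
  [set 2^-1 *: (Fplus F c p + Fminus F c p)
       + s *: (2^-1 *: (Fplus F c p - Fminus F c p)) | s in sgn_multi (h p)].

Definition Fnorm : \bar R :=
  ereal_sup [set x | exists2 p : M, True &
                     exists2 v, Fval p v & x = (tnorm G p v)%:E].

Definition bounded_system : Prop := (Fnorm < +oo)%E.

(* The function Xh = <grad h, X>. *)
Definition lie (X : vector_field M r) (p : M) : R :=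
  inner G p (gradient G h p) (X (chart_at p) p).

Definition Sigma_t : set M :=
  [set p | Sigma p /\ lie (Fplus F) p * lie (Fminus F) p = 0].
Definition Sigma_c : set M :=
  [set p | Sigma p /\ 0 < lie (Fplus F) p * lie (Fminus F) p].
Definition Sigma_s : set M :=
  [set p | Sigma p /\ lie (Fplus F) p * lie (Fminus F) p < 0].

(* Components in the chart c of the sliding vector field on Sigma_s. *)
Definition Fsliding (c : chart M) (p : M) : 'rV[R]_n.+1 :=
  (lie (Fminus F) p - lie (Fplus F) p)^-1 *:
    (lie (Fminus F) p *: Fplus F c p - lie (Fplus F) p *: Fminus F c p).

(* v is the value at p of the sliding vector field, or of its extension by
   continuity when p is a tangency point adherent to Sigma_s. *)
Definition sliding_value (p : M) (v : 'rV[R]_n.+1) : Prop :=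
  let c := chart_at p in
  (Sigma_s p /\ v = Fsliding c p) \/
  [/\ Sigma_t p, closure Sigma_s p &
      Fsliding c q @[q --> within Sigma_s (nbhs p)] --> v].

Definition has_velocity (g : R -> M) (t : R) (v : 'rV[R]_n.+1) : Prop :=
  is_derive (t : R^o) (1 : R^o) (phi (chart_at (g t)) \o g) v.

Definition plus_piece (g : R -> M) (a b : R) : Prop :=
  forall t, a < t < b ->
    Mplus (g t) /\ has_velocity g t (Fplus F (chart_at (g t)) (g t)).

Definition minus_piece (g : R -> M) (a b : R) : Prop :=
  forall t, a < t < b ->
    Mminus (g t) /\ has_velocity g t (Fminus F (chart_at (g t)) (g t)).

Definition sliding_piece (g : R -> M) (a b : R) : Prop :=
  forall t, a < t < b ->
    exists2 v, sliding_value (g t) v & has_velocity g t v.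

(* g is a Filippov orbit on the nondegenerate interval I (its values outside I
   are irrelevant), B being its locally finite set of gluing times. *)
Definition filippov_orbit (I : set R) (g : R -> M) : Prop :=
  [/\ is_interval I,
      exists s t, [/\ I s, I t & s < t],
      {within I, continuous g} &
      exists B : set R,
        [/\ B `<=` I^°,
            forall a b, I a -> I b -> finite_set (B `&` `[a, b]),
            forall a b, a < b -> `]a, b[ `<=` I `\` B ->
              [\/ plus_piece g a b, minus_piece g a b | sliding_piece g a b] &
            forall t, B t -> Sigma (g t) /\
              (Sigma_c (g t) -> exists2 e, 0 < e &
                 (plus_piece g (t - e) t /\ minus_piece g t (t + e)) \/
                 (minus_piece g (t - e) t /\ plus_piece g t (t + e)))]].

Definition maximal_orbit (I : set R) (g : R -> M) : Prop :=
  filippov_orbit I g /\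
  forall (J : set R) (k : R -> M), filippov_orbit J k -> I `<=` J ->
    (forall t, I t -> k t = g t) -> J = I.

Definition maximal_orbits_global : Prop :=
  forall (I : set R) (g : R -> M), maximal_orbit I g -> I = setT.

(* All the maximal orbits, under [maximal_orbits_global]. *)
Definition orbit_space : set (R -> M) := [set g | maximal_orbit setT g].

Definition flow (t : R) (g : R -> M) : R -> M := fun s => g (t + s).

Definition integral_dist (g0 g1 : R -> M) : \bar R :=
  \esum_(i in [set: int])
    ((2 ^- `|i|%N : R)%:E *
     \int[lebesgue_measure]_(t in `[i%:~R : R, (i + 1)%:~R : R])
       rdist G (g0 t) (g1 t))%E.

End Filippov.

Definition metric_on (R : realType) (T : Type) (A : set T)
    (d : T -> T -> \bar R) : Prop :=
  [/\ forall x y, A x -> A y -> (0 <= d x y < +oo)%E,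
      forall x y, A x -> A y -> (d x y = 0%E <-> x = y),
      forall x y, A x -> A y -> d x y = d y x &
      forall x y z, A x -> A y -> A z -> (d x z <= d x y + d y z)%E].

(* Joint continuity is for the product of the usual topology of R with the
   topology of d. *)
Definition continuous_flow_on (R : realType) (T : Type) (A : set T)
    (d : T -> T -> \bar R) (Phi : R -> T -> T) : Prop :=
  [/\ forall t x, A x -> A (Phi t x),
      forall x, A x -> Phi 0 x = x,
      forall s t x, A x -> Phi (s + t) x = Phi s (Phi t x) &
      forall t x, A x -> forall e : R, 0 < e -> exists2 e' : R, 0 < e' &
        forall s y, A y -> `|s - t| < e' -> (d x y < e'%:E)%E ->
          (d (Phi t x) (Phi s y) < e%:E)%E].

(* Main.v *)
(* The Riemannian distance d is a metric on the connected manifold M inducing its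
   topology, and to first order at p it is at most the norm of T_pM read in a chart.
   Outside a locally finite set of times an orbit has a velocity, whose norm is at
   most |F| (sliding velocities are convex combinations of F+ and F-, or limits of
   such), so orbits are |F|-Lipschitz for d.  Hence t |-> d(x(t), y(t)) is continuous
   and grows at most linearly, which makes the integral distance a finite metric.
   Since |i + m| <= |i| + |m|, shifting time by t multiplies it by at most a constant
   depending on t, while the Lipschitz bound makes s |-> Phi^s(y) Lipschitz uniformly
   in the orbit y; together these give joint continuity.

   Differentiability of curves enters only through upper one-sided growth estimates
   ([growth_le]): it yields both the Lipschitz bound for orbits and the lower bound
   on lengths that separates points. *)
From HB Require Import structures.
Require Import Defs.
From mathcomp Require Import all_boot all_order all_algebra.
From mathcomp Require Import all_classical all_reals all_analysis.
From mathcomp Require Import measurable_realfun ring lra zify.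
Set Implicit Arguments.
Unset Strict Implicit.
Unset Printing Implicit Defensive.
Import Order.TTheory GRing.Theory Num.Theory.
Import numFieldNormedType.Exports.
Local Open Scope classical_set_scope.
Local Open Scope ring_scope.

(** * One-sided growth and change of variables *)

(** The obstacle is that neither the distance from a fixed point along a curve nor a truncated
    coordinate distance need be differentiable in time, even when the curve is. Bounding their right
    difference quotients from above off a finite set of times, together with continuity, is already
    enough to integrate the estimate. For separation of points, no exit time from a coordinate ball
    is ever chosen: the coordinate distance to a point is cut off at a small radius and becomes a
    continuous function on all of the manifold, so that leaving the ball costs nothing in the
    estimate. Both comparisons between lengths and coordinates come from continuity of the Gram
    matrix. Near a point it exceeds its value there by little, which bounds the length of coordinate
    segments from above, and it keeps at least half of its coercivity, which bounds the length of
    every curve from below. *)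

Lemma within_continuous_dist (R : realType) (T : topologicalType)
    (W : normedModType R) (S : set T) (f : T -> W) :
  {within S, continuous f} <->
  forall x, S x -> forall e : R, 0 < e ->
    \forall y \near nbhs x, S y -> `|f y - f x| < e.
Proof.
split.
  move=> /subspace_continuousP fc x Sx e e0.
  have /cvgrPdist_lt /(_ _ e0) := fc x Sx.
  by rewrite near_withinE; apply: filterS => y /[swap] Sy /(_ Sy); rewrite distrC.
move=> H; apply/subspace_continuousP => x Sx.
apply/cvgrPdist_lt => e e0; rewrite near_withinE.
by apply: filterS (H x Sx e e0) => y /[swap] Sy /(_ Sy); rewrite distrC.
Qed.

Section growth.
Context (R : realType).
Implicit Types (f L : R -> R) (a b : R).

(** Continuous induction: with an added slope [k], the supremum of the times where the estimate
    holds satisfies it too, and the growth condition there would push it further right unless it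
    equals [b]. *)
Let growth_incr f L a b : a <= b ->
  {within `[a, b], continuous f} ->
  {in `[a, b] &, {homo L : x y / x <= y}} ->
  (forall t, a <= t < b -> forall e, 0 < e ->
    \forall s \near t^'+, f s - f t <= L s - L t + e * (s - t)) ->
  f b - f a <= L b - L a.
Proof.
move=> ab /within_continuous_dist fc Lm H.
apply/ler_addgt0Pr => e e0.
wlog: / a < b.
  by move: ab; rewrite le_eqVlt => /predU1P[->|? ->//]; rewrite !subrr add0r ltW.
move=> {}ab; have ba0 : 0 < b - a by rewrite subr_gt0.
(* With this slope the total slack at [b] is exactly [e]. *)
pose k := e / (b - a); have k0 : 0 < k by rewrite divr_gt0.
pose S := [set t | a <= t <= b /\ f t - f a <= L t - L a + k * (t - a)].
have Sa : S a by split; [rewrite lexx ltW | rewrite !subrr mulr0 addr0].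
have S_ub : ubound S b by move=> t [/andP[]].
have hS : has_sup S by split; [exists a | exists b].
pose c := sup S.
have ac : a <= c by apply: ub_le_sup => //; exists b.
have cb : c <= b by apply: ge_sup => //; exists a.
have cI : `[a, b]%classic c by rewrite /= in_itv/= ac cb.
(* Points of [S] approach [c] from the left, where [L] is at most [L c]; only [f] has to be
   continuous. *)
have Sc : f c - f a <= L c - L a + k * (c - a).
  apply/ler_addgt0Pr => d d0.
  have /nbhs_ballP[r /= r0 Hr] := fc c cI d d0.
  have [t St ct] := sup_adherent r0 hS.
  have tc : t <= c by apply: ub_le_sup => //; exists b.
  have [tab ft] := St.
  have tI : `[a, b]%classic t by rewrite /= in_itv.
  have := Hr t; rewrite /ball/= ger0_norm ?subr_ge0// ltrBlDr.
  have -> : c < r + t by move: ct; rewrite -/c; lra.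
  move=> /(_ isT tI); rewrite ltr_distl => /andP[h1 _].
  have h2 : L t <= L c by apply: Lm; rewrite ?inE.
  have : k * (t - a) <= k * (c - a) by rewrite ler_pM2l// lerB.
  lra.
have [cltb|] := ltP c b; last first.
  move=> bc; have cE : c = b by apply/le_anti/andP; split.
  by move: Sc; rewrite cE /k divfK// gt_eqF.
(* If [c < b], all points slightly to the right of [c] would again belong to [S]. *)
exfalso.
have : \forall s \near c^'+, False; last first.
  by move=> /filter_ex[].
have cab : a <= c < b by rewrite ac cltb.
near=> s.
have cs : c < s by near: s; exact: nbhs_right_gt.
have sb : s < b by near: s; exact: nbhs_right_lt.
have fs : f s - f c <= L s - L c + k * (s - c) by near: s; exact: H.
have : s <= c; last by rewrite leNgt cs.
apply: ub_le_sup; first by exists b.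
split; first by rewrite (le_trans ac (ltW cs)) ltW.
have -> : k * (s - a) = k * (s - c) + k * (c - a) by ring.
lra.
Unshelve. all: end_near. Qed.

(* Monotonicity stands in for continuity of L: jumps upwards do no harm. *)
Lemma growth_le (B : seq R) f L a b : a <= b ->
  {within `[a, b], continuous f} ->
  {in `[a, b] &, {homo L : x y / x <= y}} ->
  (forall t, a < t < b -> t \notin B -> forall e, 0 < e ->
    \forall s \near t^'+, f s - f t <= L s - L t + e * (s - t)) ->
  f b - f a <= L b - L a.
Proof.
elim: B a b => [|x B IH] a b ab fc Lm H.
  move: ab; rewrite le_eqVlt => /predU1P[->|ab]; first by rewrite !subrr.
  have aI : `[a, b]%classic a by rewrite /= in_itv/= lexx ltW.
  (* The growth condition is not assumed at [a] itself, so [growth_incr] is applied on [[c, b]] with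
     [c] close to [a], at the price of [e] by continuity of [f]. *)
  apply/ler_addgt0Pr => e e0.
  have : \forall c \near a^'+, f b - f a <= L b - L a + e; last first.
    by move=> /filter_ex[].
  near=> c.
  have ac : a < c by near: c; exact: nbhs_right_gt.
  have cb : c < b by near: c; exact: nbhs_right_lt.
  have cI : `[a, b]%classic c by rewrite /= in_itv/= !ltW.
  have fca : `|f c - f a| < e.
    move: cI; near: c; apply: cvg_within.
    by have /within_continuous_dist := fc; apply.
  have sub x : x \in `[c, b] -> x \in `[a, b].
    by rewrite !in_itv/= => /andP[cx ->]; rewrite (le_trans (ltW ac)).
  have : f b - f c <= L b - L c.
    apply: growth_incr; first exact: ltW.
    - by apply: (continuous_subspaceW _ fc) => y /sub.
    - by move=> ? ? /sub ? /sub ?; apply: Lm.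
    - move=> t /andP[ct tb] e' e'0; apply: H => //.
      by rewrite tb (lt_le_trans ac ct).
  have : L a <= L c by apply: Lm; rewrite ?inE// ltW.
  move: fca; rewrite ltr_distl => /andP[]; lra.
(* An exceptional time inside the interval becomes an endpoint of two subintervals, where nothing is
   asked. *)
have [/andP[ax xb]|nx] := boolP (a < x < b); last first.
  apply: IH => // t tab tB; apply: H => //; rewrite inE negb_or tB andbT.
  by apply: contra nx => /eqP <-.
have subl y : y \in `[a, x] -> y \in `[a, b].
  by rewrite !in_itv/= => /andP[-> yx]; rewrite (le_trans yx (ltW xb)).
have subr y : y \in `[x, b] -> y \in `[a, b].
  by rewrite !in_itv/= => /andP[xy ->]; rewrite (le_trans (ltW ax) xy).
have h1 : f x - f a <= L x - L a.
  apply: IH; first exact: ltW.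
  - by apply: (continuous_subspaceW _ fc) => y /subl.
  - by move=> ? ? /subl ? /subl ?; apply: Lm.
  - move=> t /andP[at0 tx] tB; apply: H; first by rewrite at0 (lt_trans tx xb).
    by rewrite inE negb_or tB lt_eqF.
have h2 : f b - f x <= L b - L x.
  apply: IH; first exact: ltW.
  - by apply: (continuous_subspaceW _ fc) => y /subr.
  - by move=> ? ? /subr ? /subr ?; apply: Lm.
  - move=> t /andP[xt tb] tB; apply: H; first by rewrite tb (lt_trans ax xt).
    by rewrite inE negb_or tB gt_eqF.
lra.
Unshelve. all: end_near. Qed.

End growth.

Section integral.
Context (R : realType).
Local Notation mu := (@lebesgue_measure R).

(** The pushforward of the measure by the affine map, scaled by [|a|], has the right value on
    intervals []c, d]], and these determine Lebesgue measure. For [a < 0] the preimage is closed at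
    the other end but has the same length. *)
Let lebesgue_measure_affine (a b : R) (A : set R) : a != 0 -> measurable A ->
  (mu A = `|a|%:E * mu [set x | A (a * x + b)%R])%E.
Proof.
move=> a0 mA.
pose phi (x : measurableTypeR R) : measurableTypeR R := a * x + b.
have mphi : measurable_fun setT phi.
  by apply: measurable_funD => //; exact: mulrl_measurable.
pose phi_mixin := isMeasurableFun.Build _ _ _ _ _ mphi.
pose phi_pack : {mfun _ >-> _} := HB.pack phi phi_mixin.
have := @lebesgue_measure_unique R (mscale (NngNum (normr_ge0 a)) (pushforward mu phi_pack)).
move=> -> //= X [[c d] _ <-] /=.
rewrite /mscale/= /pushforward.
have [agt0|alt0] : 0 < a \/ a < 0 by move: a0; rewrite neq_lt => /orP[]; auto.
- rewrite (_ : phi @^-1` `]c, d] = `](c - b) / a, (d - b) / a]%classic); last first.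
    apply/seteqP; split => x /=; rewrite !in_itv/= /phi ltr_pdivrMr// ler_pdivlMr//;
      rewrite ltrBlDr lerBrDr mulrC//.
  rewrite !lebesgue_measure_itv/= !lte_fin ltr_pM2r ?invr_gt0// ltrD2r.
  case: ifP => _; last by rewrite mule0.
  rewrite -!EFinB -EFinM gtr0_norm//; congr EFin; field; exact: a0.
- rewrite (_ : phi @^-1` `]c, d] = `[(d - b) / a, (c - b) / a[%classic); last first.
    apply/seteqP; split => x /=; rewrite !in_itv/= /phi ltr_ndivlMr// ler_ndivrMr//;
      by rewrite ltrBlDr lerBrDr mulrC// andbC.
  rewrite !lebesgue_measure_itv/= !lte_fin ltr_nM2r ?invr_lt0// ltrD2r.
  case: ifP => _; last by rewrite mule0.
  rewrite -!EFinB -EFinM ltr0_norm//; congr EFin; field; exact: a0.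
Qed.

(** Negative [a] is needed to reverse curves, [a = 2] to concatenate them and [a = 1] to shift
    orbits in time. *)
Lemma ge0_integral_affine (a b : R) (D : set R) (f : R -> \bar R) : a != 0 ->
  measurable D -> measurable_fun D f -> (forall x, D x -> 0 <= f x)%E ->
  (\int[mu]_(x in D) f x =
    `|a|%:E * \int[mu]_(x in [set x | D (a * x + b)%R]) f (a * x + b)%R)%E.
Proof.
move=> a0 mD mf f0.
pose phi (x : measurableTypeR R) : measurableTypeR R := a * x + b.
have mphi : measurable_fun setT phi.
  by apply: measurable_funD => //; exact: mulrl_measurable.
pose phi_mixin := isMeasurableFun.Build _ _ _ _ _ mphi.
pose phi_pack : {mfun _ >-> _} := HB.pack phi phi_mixin.
have H := @ge0_integral_pushforward _ _ _ _ R phi mphi mu D f mD mf.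
rewrite -[X in (_ * X)%E]H; last by move=> y; rewrite inE; exact: f0.
rewrite -(@ge0_integral_mscale _ _ R (pushforward mu phi_pack) D mD (NngNum (normr_ge0 a))) //.
apply: eq_measure_integral => A mA _.
exact: lebesgue_measure_affine.
Qed.

(** This lower bound on the increments of a primitive replaces the fundamental theorem of calculus
    when arc length plays the role of [L] in [growth_le]. *)
Lemma integral_itv_growth (f : R -> R) (t s m : R) : 0 <= t <= s ->
  measurable_fun `[0, s] f -> (forall x, 0 <= f x) -> 0 <= m ->
  (forall x, t < x <= s -> m <= f x) ->
  (\int[mu]_(x in `[0%R, t]) (f x)%:E + (m * (s - t))%:E
    <= \int[mu]_(x in `[0%R, s]) (f x)%:E)%E.
Proof.
move=> /andP[t0 ts] mf f0 m0 mle.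
have sE : `[0, s]%classic = `[0, t]%classic `|` `]t, s]%classic :> set R.
  apply/seteqP; split => x /=; rewrite !in_itv/=.
    by move=> /andP[-> ->]; case: (leP x t); [left|right].
  by move=> [/andP[-> xt]|/andP[tx ->]]; [rewrite (le_trans xt)|rewrite (le_trans t0 (ltW tx))].
rewrite sE ge0_integral_setU//=; last 3 first.
- by rewrite -sE; exact/measurable_EFinP.
- by move=> x _; rewrite lee_fin.
- rewrite disj_set2E; apply/eqP; rewrite -subset0 => x/= []; rewrite !in_itv/=.
  by move=> /andP[_ xt] /andP[]; rewrite ltNge xt.
apply: leeD => //.
have -> : ((m * (s - t))%:E = \int[mu]_(x in `]t, s]) m%:E)%E.
  rewrite integral_cst//= lebesgue_measure_itv/= lte_fin EFinM.
  by move: ts; rewrite le_eqVlt => /predU1P[->|->]; rewrite ?subrr ?ltxx// mule0.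
apply: ge0_le_integral => //=.
apply/measurable_EFinP; apply: measurable_funS mf => //.
by rewrite sE; right.
Qed.

End integral.

(** * Derivatives relative to a set *)

Section has_diff.
Context (R : realType).

(** [has_diff_within] asks only for linearity, but the chain rule needs a bounded derivative; for
    row vectors and reals, boundedness follows from linearity. *)
Definition bounded_op (V W : normedModType R) (L : V -> W) : Prop :=
  exists2 K : R, 0 < K & forall v, `|L v| <= K * `|v|.

Lemma bounded_op_R (W : normedModType R) (L : R^o -> W) :
  linear L -> bounded_op L.
Proof.
move=> linL; exists (`|L 1| + 1) => [|v]; first by rewrite ltr_wpDl.
have -> : L v = v *: L 1.
  pose LL := GRing.isLinear.Build R R^o W _ L linL.
  pose LP : {linear R^o -> W} := HB.pack L LL.
  by rewrite -[L]/(LP : _ -> _) -linearZ /= /GRing.scale/= mulr1.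
by rewrite normrZ mulrC ler_wpM2r// lerDl.
Qed.

Lemma mx_entry_norm m n (A : 'M[R]_(m, n)) i j : `|A i j| <= `|A|.
Proof.
rewrite [leRHS]/Num.norm/= mx_normrE.
exact: (le_bigmax 0 (fun ij : 'I_m * 'I_n => `|A ij.1 ij.2|) (i, j)).
Qed.

Lemma bounded_op_rV n (W : normedModType R) (L : 'rV[R]_n -> W) :
  linear L -> bounded_op L.
Proof.
move=> linL.
pose LL := GRing.isLinear.Build R 'rV[R]_n W _ L linL.
pose LP : {linear 'rV[R]_n -> W} := HB.pack L LL.
exists (\sum_i `|L (delta_mx 0 i)| + 1) => [|v].
  by rewrite ltr_wpDl// sumr_ge0.
rewrite -[L]/(LP : _ -> _) {1}(row_sum_delta v) linear_sum.
apply: (le_trans (ler_norm_sum _ _ _)).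
apply: (@le_trans _ _ (\sum_i `|LP (delta_mx 0 i)| * `|v|)).
  by apply: ler_sum => i _; rewrite linearZ normrZ mulrC ler_wpM2l// mx_entry_norm.
by rewrite -mulr_suml ler_wpM2r// lerDl.
Qed.

Lemma near_dist (V : normedModType R) (x : V) (e : R) : 0 < e ->
  \forall y \near x, `|y - x| < e.
Proof.
by move=> e0; apply/nbhs_ballP; exists e => //= y; rewrite -ball_normE/= distrC.
Qed.

Lemma linear_fun0 (V W : normedModType R) (L : V -> W) : linear L -> L 0 = 0.
Proof. by move=> /(_ (-1) 0 0); rewrite scaleN1r oppr0 addr0 scaleN1r addNr. Qed.

Lemma linear_funB (V W : normedModType R) (L : V -> W) (u v : V) :
  linear L -> L (u - v) = L u - L v.
Proof. by move=> linL; rewrite addrC -scaleN1r linL scaleN1r addrC. Qed.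

Lemma linear_funZ (V W : normedModType R) (L : V -> W) (a : R) (v : V) :
  linear L -> L (a *: v) = a *: L v.
Proof. by move=> lL; have := lL a v 0; rewrite (linear_fun0 lL) !addr0. Qed.

Lemma has_diff_within_lip (V W : normedModType R) (S : set V) (f : V -> W) x L :
  bounded_op L -> has_diff_within S f x L ->
  exists2 K : R, 0 < K & \forall y \near within S (nbhs x),
    `|f y - f x| <= K * `|y - x|.
Proof.
move=> [K K0 LK] [_ /(_ 1 ltr01) H]; exists (K + 1); first by rewrite addr_gt0.
apply: filterS H => y; rewrite mul1r => Hy.
have -> : f y - f x = (f y - f x - L (y - x)) + L (y - x) by rewrite subrK.
by rewrite (le_trans (ler_normD _ _))// addrC mulrDl mul1r lerD.
Qed.

Lemma has_diff_within_comp (U V W : normedModType R) (S : set U) (T : set V)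
    (f : U -> V) (g : V -> W) x L L' :
  bounded_op L -> bounded_op L' -> (forall y, S y -> T (f y)) ->
  has_diff_within S f x L -> has_diff_within T g (f x) L' ->
  has_diff_within S (g \o f) x (L' \o L).
Proof.
move=> bL bL' ST df dg.
have [K K0 fK] := has_diff_within_lip bL df.
case: bL' => K' K'0 L'K; case: df dg => linL Hf [linL' Hg].
split=> [a u v /=|e e0]; first by rewrite linL linL'.
(* The error of [g] is measured against [f y - f x], hence divided by the Lipschitz constant [K] of
   [f]; the error of [f] passes through [L'], hence is divided by [K']. *)
have e1 : 0 < e / 2 / K by rewrite !divr_gt0.
have e2 : 0 < e / 2 / K' by rewrite !divr_gt0.
move: (Hg _ e1) (Hf _ e2) fK; rewrite !near_withinE => /nbhs_ballP[r /= r0 Hr].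
move=> Hf2 fK; near=> y => Sy /=.
have fyK : `|f y - f x| <= K * `|y - x| by move: Sy; near: y.
have h1 : `|g (f y) - g (f x) - L' (f y - f x)| <= e / 2 / K * `|f y - f x|.
  apply: Hr; last exact: ST.
  rewrite -ball_normE/= distrC (le_lt_trans fyK)// -ltr_pdivlMl//.
  by near: y; apply: near_dist; rewrite mulr_gt0// invr_gt0.
have h2 : `|f y - f x - L (y - x)| <= e / 2 / K' * `|y - x|.
  by move: Sy; near: y.
have -> : g (f y) - g (f x) - L' (L (y - x)) =
    (g (f y) - g (f x) - L' (f y - f x)) + L' (f y - f x - L (y - x)).
  by rewrite (linear_funB (f y - f x) _ linL') addrA subrK.
rewrite (le_trans (ler_normD _ _))// [in leRHS](splitr e) mulrDl lerD//.
  rewrite (le_trans h1)// (le_trans (ler_wpM2l (ltW e1) fyK))//.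
  by rewrite mulrA divfK// gt_eqF.
rewrite (le_trans (L'K _))// (le_trans (ler_wpM2l (ltW K'0) h2))//.
by rewrite mulrA [K' * _]mulrC divfK// gt_eqF.
Unshelve. all: end_near. Qed.

Lemma has_diff_within_is_derive (W : normedModType R) (S : set R) (f : R -> W)
    (t : R) (L : R^o -> W) : nbhs t S ->
  @has_diff_within R R^o W S f t L -> is_derive (t : R^o) (1 : R^o) f (L 1).
Proof.
move=> tS [linL H].
have c : (fun h => h^-1 *: ((f \o shift (t : R^o)) (h *: 1) - f t)) @ 0^' --> L 1.
  apply/cvgrPdist_le => e e0.
  have /nbhs_ballP[r /= r0 Hr] : \forall y \near (t : R^o),
      `|f y - f t - L (y - t)| <= e * `|y - t|.
    move: (H e e0); rewrite near_withinE => {}H; near=> y.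
    have : S y by near: y.
    by near: y.
  near=> h.
  have h0 : h != 0 by near: h; exact: nbhs_dnbhs_neq.
  have := Hr (h + t); rewrite -ball_normE/= distrC addrK.
  have -> : `|h| < r.
    by near: h; apply: dnbhs0_lt.
  move=> /(_ isT) Hh.
  have -> : L 1 - h^-1 *: (f (h *: (1 : R^o) + t) - f t) =
      - (h^-1 *: (f (h + t) - f t - L h)).
    rewrite -scalerN opprB [h *: _]mulr1 [in RHS]scalerBr.
    rewrite -(linear_funZ _ _ linL) [_ *: h](mulVf h0).
    by rewrite [in RHS]opprB -[in RHS]scalerN opprB.
  rewrite normrN normrZ normfV ler_pdivrMl ?normr_gt0// mulrC.
  exact: Hh.
by apply: DeriveDef; [exact: cvgP c|exact: cvg_lim c].
Unshelve. all: end_near. Qed.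

Lemma is_derive_has_diff_within (W : normedModType R) (S : set R) (f : R -> W)
    (t : R) (v : W) : is_derive (t : R^o) (1 : R^o) f v ->
  @has_diff_within R R^o W S f t (fun h : R^o => h *: v).
Proof.
move=> [df fv]; split=> [a u w|e e0].
  by rewrite scalerDl scalerA.
have : (fun h => h^-1 *: ((f \o shift (t : R^o)) (h *: 1) - f t)) @ 0^' --> v.
  by rewrite -fv.
move=> /cvgrPdist_le /(_ e e0) /nbhs_ballP[r /= r0 Hr].
rewrite near_withinE; near=> y => _.
have [->|yt] := eqVneq y t; first by rewrite !subrr scale0r subr0 !normr0 mulr0.
have yt0 : y - t != 0 by rewrite subr_eq0.
have := Hr (y - t); rewrite -ball_normE/= sub0r normrN.
have -> : `|y - t| < r by near: y; exact: (@near_dist R^o).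
move=> /(_ isT yt0); rewrite [_ *: 1]mulr1 subrK => Hy.
have -> : f y - f t - (y - t) *: v = - ((y - t) *: (v - (y - t)^-1 *: (f y - f t))).
  by rewrite -[in RHS]scalerN opprB [in RHS]scalerBr scalerA divff// scale1r.
by rewrite normrN normrZ mulrC ler_wpM2r.
Unshelve. all: end_near. Qed.

End has_diff.

(** * Charts and speed *)

Section bilinear.
Context (R : realType) (n : nat).
Implicit Types (A : 'M[R]_n) (u v : 'rV[R]_n).

Lemma bilinE A u v : bilin A u v = \sum_j (\sum_k u 0 k * A k j) * v 0 j.
Proof.
by rewrite /bilin mxE; apply: eq_bigr => j _; rewrite !mxE.
Qed.

(** The norms are largest absolute entries, so each of the [n ^ 2] terms obeys the same bound. *)
Lemma bilin_le A u v : `|bilin A u v| <= n%:R ^+ 2 * `|A| * `|u| * `|v|.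
Proof.
rewrite bilinE; apply: (le_trans (ler_norm_sum _ _ _)).
have -> : n%:R ^+ 2 * `|A| * `|u| * `|v| = \sum_(j < n) \sum_(k < n) `|u| * `|A| * `|v|.
  by rewrite !sumr_const !card_ord -mulrnA -[in RHS]mulr_natr natrM expr2; ring.
apply: ler_sum => j _; rewrite normrM -mulr_suml ler_pM ?mx_entry_norm//.
apply: (le_trans (ler_norm_sum _ _ _)); apply: ler_sum => k _.
by rewrite normrM ler_pM ?mx_entry_norm.
Qed.

Lemma bilinZ A a u : bilin A (a *: u) (a *: u) = a ^+ 2 * bilin A u u.
Proof.
by rewrite /bilin linearZ/= -scalemxAr -!scalemxAl mxE mxE expr2 mulrA.
Qed.

Lemma bilinBm A B u v : bilin (A - B) u v = bilin A u v - bilin B u v.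
Proof. by rewrite /bilin mulmxBr mulmxBl !mxE. Qed.

Let cvg_bigsum (T I : Type) (F : set_system T) (FF : Filter F) (r : seq I)
    (f : I -> T -> R) (l : I -> R) :
  (forall i, f i x @[x --> F] --> l i) ->
  \sum_(i <- r) f i x @[x --> F] --> \sum_(i <- r) l i.
Proof.
move=> fl; elim: r => [|i r IH].
  by under eq_fun do rewrite big_nil; rewrite big_nil; exact: cvg_cst.
under eq_fun do rewrite big_cons.
by rewrite big_cons; apply: cvgD.
Qed.

Lemma bilin_cvg (T : Type) (F : set_system T) (FF : Filter F)
    (A_ : T -> 'M[R]_n) (u_ v_ : T -> 'rV[R]_n) A u v :
  A_ x @[x --> F] --> A -> u_ x @[x --> F] --> u -> v_ x @[x --> F] --> v ->
  bilin (A_ x) (u_ x) (v_ x) @[x --> F] --> bilin A u v.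
Proof.
move=> cA cu cv.
have entry p q (B_ : T -> 'M[R]_(p, q)) (B : 'M[R]_(p, q)) i j :
    B_ x @[x --> F] --> B -> B_ x i j @[x --> F] --> B i j.
  move=> cB; apply/cvgrPdist_lt => e e0.
  move/cvgrPdist_lt : cB => /(_ e e0); apply: filterS => x.
  apply: le_lt_trans.
  have -> : B i j - B_ x i j = (B - B_ x) i j by rewrite !mxE.
  exact: mx_entry_norm.
under eq_fun do rewrite bilinE.
rewrite bilinE; apply: cvg_bigsum => j; apply: cvgM; last exact: entry.
by apply: cvg_bigsum => k; apply: cvgM; exact: entry.
Qed.

End bilinear.

Section manifold_charts.
Context (R : realType) (n : nat) (M : manifold R n).
Implicit Types (c : chart M) (p q : M).

Lemma phi_half_space c p : dom c p -> half_space (phi c p).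
Proof.
move=> cp; have [V _ E] := phi_open c.
by have : (phi c @` dom c) (phi c p) by [exists p]; rewrite E => -[].
Qed.

Lemma chart_ball c p : dom c p -> exists2 r : R, 0 < r &
  forall x, half_space x -> `|x - phi c p| < r -> (phi c @` dom c) x.
Proof.
move=> cp; have [V oV E] := phi_open c.
have : (phi c @` dom c) (phi c p) by exists p.
rewrite E => -[Vp _].
have /nbhs_ballP[r /= r0 Hr] : nbhs (phi c p) V by exact: open_nbhs_nbhs.
exists r => // x hx xr; split=> //; apply: Hr.
by rewrite -ball_normE/= distrC.
Qed.

Lemma psiP c x : (phi c @` dom c) x -> dom c (psi c x) /\ phi c (psi c x) = x.
Proof.
by move=> [p cp <-]; have -> : psi c (phi c p) = p by apply: phiK; rewrite inE.
Qed.

Lemma phi_cvg c p : dom c p -> phi c q @[q --> p] --> phi c p.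
Proof.
move=> cp; apply/cvgrPdist_lt => e e0.
have /within_continuous_dist/(_ p cp e e0) := @phi_continuous _ _ M c.
have : nbhs p (dom c) by apply: open_nbhs_nbhs; split=> //; exact: dom_open.
by apply: filterS2 => q cq /(_ cq); rewrite distrC.
Qed.

Lemma chart_cvg (W : normedModType R) (g : M -> W) c p :
  {within phi c @` dom c, continuous (fun x => g (psi c x))} -> dom c p ->
  g q @[q --> p] --> g p.
Proof.
move=> /within_continuous_dist H cp; apply/cvgrPdist_lt => e e0.
have := H (phi c p) (ex_intro2 _ _ p cp erefl) e e0.
move=> /(phi_cvg cp) /=.
have : nbhs p (dom c) by apply: open_nbhs_nbhs; split=> //; exact: dom_open.
apply: filterS2 => q cq /=; rewrite !phiK ?inE// distrC; apply.
by exists q.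
Qed.

Lemma transition_diff_exists c c' p : dom c p -> dom c' p ->
  exists L, is_transition_diff c c' p L.
Proof.
move=> cp c'p; have [_ [Df [H _]]] := transition_smooth c c' 1.
by exists (Df (phi c p)); apply: H; exists p.
Qed.

(** The chain rule for the transition map, relative to the times at which the curve lies in both
    chart domains; these form a neighbourhood of [t]. *)
Lemma is_derive_change_chart c c' (s : R -> M) (t : R) L v :
  s x @[x --> t] --> s t -> dom c (s t) -> dom c' (s t) ->
  is_transition_diff c c' (s t) L ->
  is_derive (t : R^o) (1 : R^o) (phi c \o s) v ->
  is_derive (t : R^o) (1 : R^o) (phi c' \o s) (L v).
Proof.
move=> st ct c't dL dv.
pose S := [set x | dom c (s x) /\ dom c' (s x)].
have tS : nbhs t S.
  have : nbhs (s t) (dom c `&` dom c').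
    by apply: filterI; apply: open_nbhs_nbhs; split=> //; exact: dom_open.
  by move=> /st.
rewrite -[v]scale1r.
apply: (has_diff_within_is_derive tS (L := L \o (fun h => h *: v))).
have := @has_diff_within_comp R R^o _ _ S (phi c @` (dom c `&` dom c'))
  (phi c \o s) (phi c' \o psi c) t (fun h => h *: v) L.
have dv' := is_derive_has_diff_within S dv.
move=> /(_ (bounded_op_R dv'.1) (bounded_op_rV dL.1)).
have SE y : S y -> (phi c @` (dom c `&` dom c')) ((phi c \o s) y).
  by move=> Sy; exists (s y).
move=> /(_ SE dv' dL) [lin H]; split=> // e e0.
move: (H e e0); rewrite !near_withinE; apply: filterS => y + Sy => /(_ Sy) /=.
by case: Sy => cy c'y; rewrite !phiK ?inE.
Qed.

End manifold_charts.

Section speed.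
Context (R : realType) (n : nat) (M : manifold R n) (G : riemannian_metric M).
Implicit Types (c : chart M) (p q : M) (s : R -> M).

Lemma gram_cvg c p : dom c p -> G c q @[q --> p] --> G c p.
Proof. by move=> cp; apply: (chart_cvg (gram_smooth G c 0).1). Qed.

Lemma gram_ge0 c p u : dom c p -> 0 <= bilin (G c p) u u.
Proof.
move=> cp; have [->|u0] := eqVneq u 0.
  by rewrite /bilin !mul0mx mxE.
exact/ltW/gram_pos.
Qed.

(** The chart used by [speed] varies with the point. Compatibility of the Gram matrices allows a
    single chart for all nearby times, without which continuity of the speed could not be
    discussed. *)
Lemma speed_chart c s (t : R) v : s x @[x --> t] --> s t -> dom c (s t) ->
  is_derive (t : R^o) (1 : R^o) (phi c \o s) v ->
  speed G s t = Num.sqrt (bilin (G c (s t)) v v).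
Proof.
move=> st ct dv.
have [L dL] := transition_diff_exists ct (dom_chart_at (s t)).
have d := is_derive_change_chart st ct (dom_chart_at (s t)) dL dv.
rewrite /speed /tnorm /inner derive1E (@derive_val _ _ _ _ _ _ _ d).
by rewrite (gram_compat G _ _ dL)//; exact: dom_chart_at.
Qed.

Lemma C1_curve_cvg (a b : R) s (t : R) : C1_curve a b s -> a < t < b ->
  s x @[x --> t] --> s t.
Proof.
move=> [/subspace_continuousP H _] tab.
have tI : nbhs t `[a, b]%classic.
  near=> y; rewrite /= in_itv/=; apply/andP; split; apply: ltW; near: y;
    [apply: lt_nbhsr|apply: lt_nbhsl]; by move: tab => /andP[].
move=> U sU.
have := H t (nbhs_singleton tI) U sU.
have : nbhs t `[a, b]%classic by [].
by apply: filterS2 => y yI /(_ yI).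
Unshelve. all: end_near. Qed.

(** At interior times the derivative relative to [[a, b]] is two-sided, so its value on [1] is a
    velocity, and it depends continuously on time at [t]. *)
Lemma C1_curve_derive (a b : R) s (t : R) c : C1_curve a b s -> a < t < b ->
  dom c (s t) -> exists w : R -> 'rV[R]_n, w x @[x --> t] --> w t /\
  \forall x \near t, [/\ s y @[y --> x] --> s x, dom c (s x) &
    is_derive (x : R^o) (1 : R^o) (phi c \o s) (w x)].
Proof.
move=> Cs tab ct; have [_ /(_ c) [_ [Df [H /(_ 1)[cD _]]]]] := Cs.
have tI : \forall x \near t, a < x < b.
  by near=> x; apply/andP; split; near: x; [apply: lt_nbhsr|apply: lt_nbhsl];
    by move: tab => /andP[].
have cn x : a < x < b -> dom c (s x) -> nbhs x (`[a, b] `&` s @^-1` dom c).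
  move=> xab cx; apply: filterI; last first.
    have : nbhs (s x) (dom c) by apply: open_nbhs_nbhs; split=> //; exact: dom_open.
    by move=> /(C1_curve_cvg Cs xab).
  near=> y; rewrite /= in_itv/=; apply/andP; split; apply: ltW; near: y;
    [apply: lt_nbhsr|apply: lt_nbhsl]; by move: xab => /andP[].
have tS := cn t tab ct.
exists (Df ^~ 1); split.
  apply/cvgrPdist_lt => e e0.
  move/within_continuous_dist : cD => /(_ t (nbhs_singleton tS) e e0).
  by move: tS; apply: filterS2 => x tx /(_ tx); rewrite distrC.
near=> x.
have xab : a < x < b by near: x.
have cx : dom c (s x) by near: x; apply: filterS tS => x [].
split=> //; first exact: C1_curve_cvg xab.
apply: has_diff_within_is_derive (cn x xab cx) _.
by apply: H; exact: nbhs_singleton (cn x xab cx).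
Unshelve. all: end_near. Qed.

Lemma speed_cvg (a b : R) s (t : R) : C1_curve a b s -> a < t < b ->
  speed G s x @[x --> t] --> speed G s t.
Proof.
move=> Cs tab; have ct := dom_chart_at (s t).
have [w [wt H]] := C1_curve_derive Cs tab ct.
have E : \forall x \near t, Num.sqrt (bilin (G (chart_at (s t)) (s x)) (w x) (w x)) = speed G s x.
  by apply: filterS H => x [sx cx dx]; rewrite (speed_chart sx cx dx).
rewrite -(nbhs_singleton E).
have cG : G (chart_at (s t)) (s x) @[x --> t] --> G (chart_at (s t)) (s t).
  exact: cvg_comp (C1_curve_cvg Cs tab) (gram_cvg ct).
apply: (cvg_trans _ (cvg_comp _ _ (bilin_cvg _ cG wt wt) (@sqrt_continuous R _))).
exact: near_eq_cvg.
Qed.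

End speed.

(** * Piecewise C1 curves *)

Section piecewise.
Context (R : realType) (n : nat) (M : manifold R n) (G : riemannian_metric M).
Implicit Types (p q : M) (s : R -> M).

Lemma finite_gap (B : seq R) (t : R) : exists2 e : R, 0 < e &
  forall x, x \in B -> x != t -> e <= `|x - t|.
Proof.
elim: B => [|y B [e e0 IH]]; first by exists 1.
have [->|yt] := eqVneq y t.
  exists e => // x; rewrite inE => /predU1P[->|]; last exact: IH.
  by rewrite eqxx.
exists (Num.min e `|y - t|); first by rewrite lt_min e0 normr_gt0 subr_eq0.
move=> x; rewrite inE => /predU1P[-> _|xB xt]; first by rewrite ge_min lexx orbT.
by rewrite ge_min IH.
Qed.

Lemma piecewise_C1_regular s : piecewise_C1 s -> exists B : seq R,
  forall t, 0 < t < 1 -> t \notin B -> exists a b, a < t < b /\ C1_curve a b s.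
Proof.
move=> [B HB]; exists B => t /andP[t0 t1] tB.
have [e e0 He] := finite_gap B t.
exists (Num.max 0 (t - e)), (Num.min 1 (t + e)); split.
  by rewrite gt_max lt_min t0 t1 ltrBlDr ltrDl e0.
apply: HB.
- by rewrite le_max lexx.
- by rewrite (@lt_trans _ _ t)// ?gt_max ?lt_min ?t0 ?t1 ?ltrBlDr ltrDl e0.
- by rewrite ge_min lexx.
move=> x xB; apply/negP; rewrite gt_max lt_min => /andP[/andP[_ h1] /andP[_ h2]].
have : x != t by apply: contraNneq tB => <-.
move=> /(He x xB); rewrite leNgt ltr_distl ltrBlDr -ltrBlDr h1/=.
by rewrite h2.
Qed.

(** Only closed pieces free of interior break points are known to be continuous. Both pieces
    adjacent to [t] contain [t], so their one-sided limits are the same value [s t]. *)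
Lemma piecewise_C1_continuous s : piecewise_C1 s -> {within `[0, 1], continuous s}.
Proof.
move=> [B HB]; apply/subspace_continuousP => t; rewrite /= in_itv/= => /andP[t0 t1] U sU.
have [e e0 He] := finite_gap B t.
have noB x : `|x - t| < e -> x != t -> x \notin B.
  by move=> xt xnt; apply/negP => /He/(_ xnt); rewrite leNgt xt.
have right : \forall x \near t, t < x <= 1 -> U (s x).
  have [tlt1|] := ltP t 1; last first.
    move=> t1'; near=> x => /andP[tx x1].
    by have := lt_le_trans tx (le_trans x1 t1'); rewrite ltxx.
  pose b := Num.min 1 (t + e).
  have tb : t < b by rewrite lt_min tlt1 ltrDl.
  have [/subspace_continuousP sc _] : C1_curve t b s.
    apply: HB => //; first by rewrite ge_min lexx.
    move=> x xB; apply/negP => /andP[tx]; rewrite lt_min => /andP[_ xe].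
    have := noB x; rewrite xB gt_eqF// gtr0_norm ?subr_gt0// ltrBlDl xe.
    by move=> /(_ isT isT).
  have tI : `[t, b]%classic t by rewrite /= in_itv/= lexx ltW.
  have h1 : \forall x \near t, `[t, b]%classic x -> U (s x) := sc t tI U sU.
  have h2 : \forall x \near t, x < b by exact: lt_nbhsl.
  move: h1 h2; apply: filterS2 => x /= + xb /andP[tx _]; apply.
  by rewrite in_itv/= !ltW.
have left : \forall x \near t, 0 <= x < t -> U (s x).
  have [tgt0|] := ltP 0 t; last first.
    move=> t0'; near=> x => /andP[x0 xt].
    by have := le_lt_trans (le_trans t0' x0) xt; rewrite ltxx.
  pose a := Num.max 0 (t - e).
  have at_ : a < t by rewrite gt_max tgt0 ltrBlDr ltrDl.
  have [/subspace_continuousP sc _] : C1_curve a t s.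
    apply: HB => //; first by rewrite le_max lexx.
    move=> x xB; apply/negP => /andP[+ xt]; rewrite gt_max => /andP[_ xe].
    have := noB x; rewrite xB lt_eqF// distrC gtr0_norm ?subr_gt0//.
    by rewrite ltrBlDr -ltrBlDl xe => /(_ isT isT).
  have tI : `[a, t]%classic t by rewrite /= in_itv/= lexx andbT ltW.
  have h1 : \forall x \near t, `[a, t]%classic x -> U (s x) := sc t tI U sU.
  have h2 : \forall x \near t, a < x by exact: lt_nbhsr.
  move: h1 h2; apply: filterS2 => x /= + ax /andP[_ xt]; apply.
  by rewrite in_itv/= !ltW.
move: right left; apply: filterS2 => x /= h1 h2; rewrite in_itv/= => /andP[x0 x1].
have [xt|tx|->] := ltgtP x t.
- by apply: h2; rewrite x0.
- by apply: h1; rewrite tx.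
- exact: nbhs_singleton.
Unshelve. all: end_near. Qed.

Lemma speed_ge0 s t : 0 <= speed G s t.
Proof. exact: sqrtr_ge0. Qed.

Let finite_measurable (A : set R) : finite_set A -> measurable A.
Proof.
move=> fA; apply: countable_measurable; last exact: finite_set_countable.
by move=> x; exact: measurable_set1.
Qed.

(* The junk values of [derive1] at break points lie in a finite set. *)
Lemma measurable_speed s : piecewise_C1 s -> measurable_fun `[0 : R, 1] (speed G s).
Proof.
move=> /piecewise_C1_regular[B HB].
pose D : set R := `]0, 1[%classic `\` [set` B].
have oD : open D.
  apply: openI; first exact: interval_open.
  apply: closed_openC.
  have /accessible_finite_set_closed := hausdorff_accessible (@Rhausdorff R).
  by apply; exact: finite_seq.
pose N : set R := `[0, 1]%classic `\` D.
rewrite (_ : `[0, 1]%classic = D `|` N); last first.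
  apply/esym/setDUK => x [+ _] /=; rewrite !in_itv/=.
  by move=> /andP[? ?]; rewrite !ltW.
have fN : finite_set N.
  apply: (@sub_finite_set _ _ ([set 0] `|` [set 1] `|` [set` B])); last first.
    by rewrite !finite_setU; split; [split; exact: finite_set1|exact: finite_seq].
  move=> x [/= x01 nD]; apply: contrapT => H; apply: nD; split; last first.
    by move=> xB; apply: H; right.
  move: x01; rewrite /= !in_itv/= !le_eqVlt => /andP[/predU1P[x0|->]].
    by exfalso; apply: H; left; left.
  move=> /predU1P[x1|-> //].
  by exfalso; apply: H; left; right.
apply/measurable_funU.
- exact: open_measurable.
- exact: finite_measurable.
split.
  apply: open_continuous_measurable_fun => // t; rewrite inE => -[/=].
  rewrite in_itv/= => t01 tB.
  have [|a [b [tab Cs]]] := HB t t01; first exact/negP.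
  exact: speed_cvg Cs tab.
move=> _ Y mY; apply: finite_measurable.
exact: finite_setIl.
Qed.

Lemma curve_length_ge0 s : (0 <= curve_length G s)%E.
Proof. by apply: integral_ge0 => t _; rewrite lee_fin speed_ge0. Qed.

Lemma rdist_ge0 p q : (0 <= rdist G p q)%E.
Proof. by apply: le_ereal_inf_tmp => _ [s _ <-]; exact: curve_length_ge0. Qed.

Lemma rdist_le s p q : piecewise_C1 s -> s 0 = p -> s 1 = q ->
  (rdist G p q <= curve_length G s)%E.
Proof. by move=> Cs s0 s1; apply: ereal_inf_lbound; exists s. Qed.

Lemma within_continuous_compose (T U V : topologicalType) (S' : set T) (S : set U)
    (f : T -> U) (g : U -> V) (g' : T -> V) : {within S, continuous g} ->
  continuous f -> (forall x, S' x -> S (f x)) ->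
  (forall x, S' x -> g' x = g (f x)) -> {within S', continuous g'}.
Proof.
move=> /subspace_continuousP gc fc SS gE; apply/subspace_continuousP => x Sx U0 g'U.
have gU : nbhs (g (f x)) U0 by rewrite -(gE x Sx).
have H : \forall y \near f x, S y -> U0 (g y) := gc _ (SS x Sx) U0 gU.
have {}H : \forall y \near x, S (f y) -> U0 (g (f y)) := fc x _ H.
change (\forall y \near x, S' y -> U0 (g' y)).
by apply: filterS H => y + Sy; rewrite gE//; apply; exact: SS.
Qed.

Let affine_continuous (al be : R) : continuous (fun x : R => al * x + be).
Proof.
move=> x; apply: cvgD; last exact: cvg_cst.
by apply: cvgM; [exact: cvg_cst|exact: cvg_id].
Qed.

Lemma has_diff_within_affine (al be : R) (S : set R^o) (t : R^o) :
  @has_diff_within R R^o R^o S (fun x => al * x + be) t (fun h => al * h).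
Proof.
split=> [a u v|e e0]; first by rewrite mulrDr /GRing.scale/=; ring.
rewrite near_withinE; near=> y => _.
have -> : al * y + be - (al * t + be) - al * (y - t) = 0 by ring.
by rewrite normr0 mulr_ge0// ltW.
Unshelve. all: end_near. Qed.

Lemma C1_curve_affine (al be a b a' b' : R) s s' : C1_curve a' b' s ->
  (forall t, a <= t <= b -> a' <= al * t + be <= b') ->
  (forall t, a <= t <= b -> s' t = s (al * t + be)) ->
  C1_curve a b s'.
Proof.
move=> [sc Cs] I s'E; split.
  apply: (within_continuous_compose sc (affine_continuous (al := al) (be := be))) => x;
    rewrite /= in_itv/=; [exact: I|exact: s'E].
move=> c; have [cc [Df [dD cD]]] := Cs c.
set S := `[a', b'] `&` s @^-1` dom c in cc dD cD.
have SS x : (`[a, b] `&` s' @^-1` dom c) x -> S (al * x + be).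
  by move=> [/=]; rewrite in_itv/= => xab; rewrite s'E// => cx; split=> //=; rewrite in_itv/= I.
have gE x : (`[a, b] `&` s' @^-1` dom c) x -> (phi c \o s') x = (phi c \o s) (al * x + be).
  by move=> [/=]; rewrite in_itv/= => /s'E ->.
split.
  exact: (within_continuous_compose cc (affine_continuous (al := al) (be := be)) SS gE).
exists (fun x v => Df (al * x + be) (al * v)); split.
  move=> x Sx.
  have dx := dD _ (SS x Sx).
  have da := has_diff_within_affine al be (`[a, b] `&` s' @^-1` dom c) x.
  have [lin H] := has_diff_within_comp (bounded_op_R da.1) (bounded_op_R dx.1) SS da dx.
  split=> // e e0; move: (H e e0); rewrite !near_withinE.
  apply: filterS => y + Sy => /(_ Sy).
  by rewrite (gE y Sy) (gE x Sx).
move=> v; split=> //.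
exact: (within_continuous_compose (cD (al * v)).1 (affine_continuous (al := al) (be := be)) SS).
Qed.

Lemma speed_affine (al be a b t : R) s s' : C1_curve a b s ->
  a < al * t + be < b -> (\forall x \near t, s' x = s (al * x + be)) ->
  speed G s' t = `|al| * speed G s (al * t + be).
Proof.
move=> Cs tab s'E.
have s't := nbhs_singleton s'E; rewrite /= in s't.
set c := chart_at (s' t).
have ct' : dom c (s' t) by exact: dom_chart_at.
have ct : dom c (s (al * t + be)) by rewrite -s't.
have [w [_ /nbhs_singleton[sc _ dw]]] := C1_curve_derive Cs tab ct.
have s'c : s' x @[x --> t] --> s' t.
  rewrite s't; apply: (cvg_trans _ (cvg_comp _ _ (@affine_continuous al be t) sc)).
  by apply: near_eq_cvg; apply: filterS s'E => x ->.
rewrite (speed_chart G sc ct dw).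
have dw' : is_derive (t : R^o) (1 : R^o) (phi c \o s') (al *: w (al * t + be)).
  have := is_derive_has_diff_within setT dw.
  have da := has_diff_within_affine al be [set x | s' x = s (al * x + be)] t.
  move=> dw0.
  have SS x : [set x | s' x = s (al * x + be)] x -> [set: R^o] (al * x + be) by [].
  have [lin H] := has_diff_within_comp (bounded_op_R da.1) (bounded_op_R dw0.1) SS da dw0.
  rewrite -[X in X *: _](mulr1 al).
  apply: (@has_diff_within_is_derive R _ _ _ t
    (fun h : R^o => (al * h) *: w (al * t + be)) s'E).
  split; first exact: lin.
  move=> e e0; move: (H e e0); rewrite !near_withinE.
  by apply: filterS => y + Sy => /(_ Sy); rewrite /= Sy s't.
rewrite (speed_chart G s'c ct' dw') bilinZ s't sqrtrM ?sqr_ge0//.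
by rewrite sqrtr_sqr.
Qed.
End piecewise.

(** * The Riemannian distance *)

Section rdist_triangle.
Context (R : realType) (n : nat) (M : manifold R n) (G : riemannian_metric M).
Implicit Types (p q : M) (s : R -> M).
Local Notation mu := (@lebesgue_measure R).

(** The chain rule for speeds holds only at regular interior times; the remaining times form a
    finite, hence null, set. *)
Lemma integral_speed_affine (al be u v : R) s s' : piecewise_C1 s ->
  piecewise_C1 s' -> al != 0 -> 0 <= u -> v <= 1 ->
  (forall x, (0 <= al * x + be <= 1) = (u <= x <= v)) ->
  (forall x, u <= x <= v -> s' x = s (al * x + be)) ->
  (\int[mu]_(t in `[u, v]) (speed G s' t)%:E = curve_length G s)%E.
Proof.
move=> Cs Cs' al0 u0 v1 uvE s'E; rewrite /curve_length.
have ms := measurable_speed G Cs.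
have maff (D : set R) : measurable_fun D (fun x : R => al * x + be).
  by apply: measurable_funD => //; exact: mulrl_measurable.
have mss : measurable_fun `[u, v] (speed G s \o (fun x : R => al * x + be)).
  apply: (measurable_comp (F := `[0 : R, 1]%classic)) => //.
  by move=> _ [x /= + <-]; rewrite !in_itv/= uvE.
have mE : measurable_fun `[0 : R, 1] (EFin \o speed G s) by exact/measurable_EFinP.
have mssE : measurable_fun `[u, v] (fun t => (speed G s (al * t + be))%:E).
  exact/measurable_EFinP.
have s0 x : (0 <= (EFin \o speed G s) x)%E by rewrite lee_fin speed_ge0.
have := ge0_integral_affine be al0 (measurable_itv `[0 : R, 1]) mE (fun x _ => s0 x).
rewrite /= => ->.
have -> : [set x | al * x + be \in `[0, 1]] = `[u, v]%classic.
  by apply/seteqP; split => x; rewrite /= !in_itv/= uvE.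
rewrite -(@ge0_integralZl _ _ _ mu _ _ (fun t => (speed G s (al * t + be))%:E))//; last first.
  by move=> x _; exact: s0.
have [B HB] := piecewise_C1_regular Cs.
(* At [u] and [v] the derivative of [s'] also sees values outside [[u, v]], which are arbitrary; the
   other points are the preimages of the endpoints and break points of [s]. *)
pose N : set R := [set` [:: u, v & [seq (y - be) / al | y <- 0 :: 1 :: B]]].
have ms' : measurable_fun `[u, v] (EFin \o speed G s').
  apply/measurable_EFinP; apply: measurable_funS (measurable_speed G Cs') => //.
  move=> x /=; rewrite !in_itv/= => /andP[ux xv].
  by rewrite (le_trans u0 ux) (le_trans xv v1).
have msal := @measurable_funeM _ _ _ _ _ `|al|%:E mssE.
have := @ae_eq_integral _ _ _ mu _ _ _ (measurable_itv _) ms' msal; apply.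
exists N; split.
- apply: countable_measurable; first by move=> t; exact: measurable_set1.
  by apply: finite_set_countable; exact: finite_seq.
- by apply: countable_lebesgue_measure0; apply: finite_set_countable; exact: finite_seq.
move=> t /= /not_implyP[]; rewrite in_itv/= => uvt Ht.
apply: contrapT => /negP; rewrite !inE !negb_or => /and5P[tu tv t0 t1 tB]; apply: Ht.
have aff x : (al * t + be == x) = (t == (x - be) / al).
  by apply/eqP/eqP => [<-|->]; [rewrite addrK mulrC mulKf | rewrite mulrC divfK// subrK].
move: t0 t1; rewrite -!aff => t0 t1.
have tB' : al * t + be \notin B.
  apply: contra tB => tB; apply/mapP; exists (al * t + be) => //.
  by rewrite addrK mulrC mulKf.
have t01 : 0 < al * t + be < 1.
  by have := uvE t; rewrite uvt !le_eqVlt eq_sym (negbTE t0) (negbTE t1).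
have [a [b [tab Cab]]] := HB _ t01 tB'.
rewrite (speed_affine G Cab tab) ?EFinM//.
move: uvt; rewrite !le_eqVlt eq_sym (negbTE tu) (negbTE tv)/= => /andP[ut tv'].
near=> x; apply: s'E; apply/andP; split; apply: ltW; near: x;
  [exact: lt_nbhsr|exact: lt_nbhsl].
Unshelve. all: end_near. Qed.

Lemma rdist_sym_le p q : (rdist G q p <= rdist G p q)%E.
Proof.
apply: le_ereal_inf_tmp => _ [s [Cs s0 s1] <-].
pose s' t := s (- 1 * t + 1).
have Cs' : piecewise_C1 s'.
  have [B HB] := Cs; exists [seq 1 - x | x <- B] => a b a0 ab b1 H.
  apply: (@C1_curve_affine _ _ _ (-1) 1 a b (1 - b) (1 - a) s) => //.
  - apply: HB; [lra|lra|lra|] => t tB; have := H _ (map_f (fun x => 1 - x) tB).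
    by apply: contra => /andP[? ?]; lra.
  - by move=> t /andP[? ?]; lra.
rewrite -(@integral_speed_affine (-1) 1 0 1 s s') //; last first.
  by move=> x; apply/idP/idP => /andP[? ?]; lra.
apply: rdist_le => //.
  by rewrite /s' mulr0 add0r.
by rewrite /s' mulr1 addNr.
Qed.

Lemma rdist_sym p q : rdist G p q = rdist G q p.
Proof. by apply/le_anti; rewrite !rdist_sym_le. Qed.

Lemma rdist_concat s1 s2 : piecewise_C1 s1 -> piecewise_C1 s2 -> s1 1 = s2 0 ->
  (rdist G (s1 0%R) (s2 1%R) <= curve_length G s1 + curve_length G s2)%E.
Proof.
move=> C1 C2 s12.
(* Each half runs at double speed; the trivial [+ 0] puts both branches into the same affine
   form. *)
pose s t := if t <= 2^-1 then s1 (2 * t + 0) else s2 (2 * t + - 1).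
have sE1 t : t <= 2^-1 -> s t = s1 (2 * t + 0) by rewrite /s => ->.
have sE2 t : 2^-1 <= t -> s t = s2 (2 * t + -1).
  rewrite le_eqVlt => /predU1P[<-|t2].
    by rewrite sE1// divff// addr0 subrr.
  by rewrite /s leNgt t2.
have Cs : piecewise_C1 s.
  have [[B1 HB1] [B2 HB2]] := (C1, C2).
  (* Since the junction is listed as a break point, an interval without break points inside lies
     entirely in one half. *)
  exists (2^-1 :: [seq x / 2 | x <- B1] ++ [seq (x + 1) / 2 | x <- B2]).
  move=> a b a0 ab b1 H.
  have := H 2^-1; rewrite inE eqxx => /(_ isT); rewrite negb_and -!leNgt => /orP[ha|hb].
    apply: (@C1_curve_affine _ _ _ 2 (-1) a b (2 * a - 1) (2 * b - 1) s2) => //.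
    - apply: HB2; [lra|lra|lra|] => t tB.
      have := H ((t + 1) / 2); rewrite inE mem_cat (map_f (fun x => (x + 1) / 2) tB) !orbT.
      by move=> /(_ isT); apply: contra => /andP[? ?]; lra.
    - by move=> t /andP[? ?]; lra.
    - by move=> t /andP[at_ tb]; apply: sE2; exact: le_trans at_.
  apply: (@C1_curve_affine _ _ _ 2 0 a b (2 * a) (2 * b) s1) => //.
  - apply: HB1; [lra|lra|lra|] => t tB.
    have := H (t / 2); rewrite inE mem_cat (map_f (fun x => x / 2) tB) !orbT.
    by move=> /(_ isT); apply: contra => /andP[? ?]; lra.
  - by move=> t /andP[? ?]; lra.
  - by move=> t /andP[at_ tb]; apply: sE1; exact: le_trans hb.
apply: le_trans (rdist_le _ Cs _ _) _.
- by rewrite sE1// mulr0 addr0.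
- by rewrite sE2; [congr s2; lra|lra].
have ms := measurable_speed G Cs.
rewrite -(@integral_speed_affine 2 0 0 2^-1 s1 s) //; last 3 first.
- by lra.
- by move=> x; apply/idP/idP => /andP[? ?]; lra.
- by move=> x /andP[_ /sE1].
rewrite -(@integral_speed_affine 2 (-1) 2^-1 1 s2 s) //; last 2 first.
- by move=> x; apply/idP/idP => /andP[? ?]; lra.
- by move=> x /andP[/sE2].
have E : `[0, 1]%classic = `[0, 2^-1]%classic `|` `]2^-1, 1]%classic :> set R.
  apply/seteqP; split => x /=; rewrite !in_itv/=.
    by move=> /andP[-> ->]; case: (leP x 2^-1); [left|right].
  by move=> [|] /andP[? ?]; lra.
have sub (D : set R) : D `<=` `[0, 1]%classic -> measurable_fun D (EFin \o speed G s).
  by move=> DI; apply/measurable_EFinP; apply: measurable_funS ms.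
rewrite /curve_length E ge0_integral_setU//=; last 3 first.
- by rewrite -E; exact: sub.
- by move=> x _; rewrite lee_fin speed_ge0.
- rewrite disj_set2E; apply/eqP; rewrite -subset0 => x/= []; rewrite !in_itv/=.
  by move=> /andP[_ xt] /andP[]; rewrite ltNge xt.
apply: leeD => //; apply: ge0_subset_integral => //=.
- by apply: sub => x /=; rewrite !in_itv/= => /andP[? ?]; lra.
- by move=> x _; rewrite lee_fin speed_ge0.
- by move=> x /=; rewrite !in_itv/= => /andP[/ltW -> ->].
Qed.

Lemma rdist_triangle p q z : (rdist G p z <= rdist G p q + rdist G q z)%E.
Proof.
have fin x y : (rdist G x y < +oo)%E -> rdist G x y \is a fin_num.
  by move=> h; rewrite ge0_fin_numE// rdist_ge0.
have [h1|h1] := ltP (rdist G p q) +oo%E; last first.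
  by rewrite (le_trans (leey _))// (le_trans h1)// leeDl// rdist_ge0.
have [h2|h2] := ltP (rdist G q z) +oo%E; last first.
  by rewrite (le_trans (leey _))// (le_trans h2)// leeDr// rdist_ge0.
apply/lee_addgt0Pr => e e0.
have e2 : 0 < e / 2 by rewrite divr_gt0.
have [_ [s1 [C1 s10 s11] <-] l1] := lb_ereal_inf_adherent e2 (fin _ _ h1).
have [_ [s2 [C2 s20 s21] <-] l2] := lb_ereal_inf_adherent e2 (fin _ _ h2).
have := rdist_concat C1 C2; rewrite s10 s11 s20 s21 => /(_ erefl) /le_trans; apply.
rewrite (le_trans (leeD (ltW l1) (ltW l2)))// -!/(rdist G _ _).
by rewrite addeACA -EFinD -splitr.
Qed.

End rdist_triangle.

(** * Upper bound on the distance by coordinate segments *)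

Section chart_segments.
Context (R : realType) (n : nat) (M : manifold R n) (G : riemannian_metric M).
Implicit Types (c : chart M) (p q : M).
Local Notation mu := (@lebesgue_measure R).

Let segment (x w : 'rV[R]_n) (t : R) : 'rV[R]_n := x + t *: w.

Let segment_continuous x w : continuous (segment x w).
Proof.
move=> t; apply: cvgD; first exact: cvg_cst.
by apply: cvgZr_tmp; exact: cvg_id.
Qed.

Let has_diff_within_segment x w (S : set R^o) (t : R^o) :
  @has_diff_within R R^o _ S (segment x w) t (fun h => h *: w).
Proof.
split=> [a u v|e e0]; first by rewrite scalerDl scalerA.
rewrite near_withinE; near=> y => _.
rewrite /segment opprD addrACA subrr add0r -scalerBl subrr normr0.
by rewrite mulr_ge0// ltW.
Unshelve. all: end_near. Qed.

Let C1_curve_segment c x w (a b : R) :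
  (forall t, 0 <= t <= 1 -> (phi c @` dom c) (segment x w t)) ->
  0 <= a -> b <= 1 -> C1_curve a b (psi c \o segment x w).
Proof.
move=> I a0 b1; split.
  have H t : `[a, b]%classic t -> (phi c @` dom c) (segment x w t).
    rewrite /= in_itv/= => /andP[ta tb]; apply: I.
    by rewrite (le_trans a0 ta) (le_trans tb b1).
  exact: (within_continuous_compose (@psi_continuous _ _ M c)
    (@segment_continuous x w) H).
move=> c'; have [cc [Df [dD cD]]] := transition_smooth c c' 1.
set S := `[a, b] `&` _.
have SS t : S t -> (phi c @` (dom c `&` dom c')) (segment x w t).
  move=> [/=]; rewrite in_itv/= => /andP[ta tb] c't.
  have /psiP[h1 h2] : (phi c @` dom c) (segment x w t).
    by apply: I; rewrite (le_trans a0 ta) (le_trans tb b1).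
  by exists (psi c (segment x w t)).
split.
  exact: (within_continuous_compose cc (@segment_continuous x w) SS).
exists (fun t v => Df (segment x w t) (v *: w)); split.
  move=> t St.
  have dx := dD _ (SS t St).
  have da := has_diff_within_segment x w S t.
  exact: has_diff_within_comp (bounded_op_R da.1) (bounded_op_rV dx.1) SS da dx.
move=> v; split=> //.
exact: (within_continuous_compose (cD (v *: w)).1 (@segment_continuous x w) SS).
Qed.

(** The bound is on the length of the coordinate segment from [p] to [q], whose velocity is constant
    in the chart; the term in [e] pays for replacing the Gram matrix along it by the one at [p]. *)
Lemma rdist_near c p (e : R) : dom c p -> 0 < e ->
  \forall q \near p, (rdist G p q <=
    (Num.sqrt (bilin (G c p) (phi c q - phi c p) (phi c q - phi c p)) +
     e * `|phi c q - phi c p|)%:E)%E.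
Proof.
move=> cp e0.
have [r1 r10 Hr1] := chart_ball cp.
(* By [bilin_le], a change of the Gram matrix by this amount adds at most [e ^ 2 * |w| ^ 2] under
   the square root, hence at most [e * |w|] outside it. The [+ 1] keeps the denominator positive
   when [n = 0]. *)
have d0 : 0 < e ^+ 2 / (n%:R ^+ 2 + 1).
  by rewrite divr_gt0 ?exprn_gt0// ltr_wpDl// sqr_ge0.
have /within_continuous_dist/(_ (phi c p) (ex_intro2 _ _ p cp erefl) _ d0) :=
  (gram_smooth G c 0).1.
move=> /nbhs_ballP[r2 /= r20 Hr2].
have pc : nbhs p (dom c) by apply: open_nbhs_nbhs; split=> //; exact: dom_open.
have /cvgrPdist_lt phic := phi_cvg cp.
near=> q.
have cq : dom c q by near: q.
set w := phi c q - phi c p.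
have w1 : `|w| < r1 by rewrite /w distrC; near: q; exact: phic.
have w2 : `|w| < r2 by rewrite /w distrC; near: q; exact: phic.
have I t : 0 <= t <= 1 -> (phi c @` dom c) (segment (phi c p) w t).
  move=> /andP[t0 t1]; apply: Hr1; last first.
    rewrite /segment addrAC subrr add0r normrZ ger0_norm//.
    by rewrite (le_lt_trans _ w1)// ler_piMl.
  (* The half-space is convex, so the segment stays in it even when [p] or [q] is a boundary
     point. *)
  move=> i i0; rewrite !mxE.
  have := phi_half_space cp i0; have := phi_half_space cq i0; nra.
set s := psi c \o segment (phi c p) w.
have Cs : piecewise_C1 s.
  by exists [::] => a b a0 ab b1 _; exact: C1_curve_segment.
apply: le_trans (rdist_le G Cs _ _) _.
- by rewrite /s /= /segment scale0r addr0 phiK// inE.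
- by rewrite /s /= /segment scale1r /w addrC subrK phiK// inE.
set m := (X in (_ <= X%:E)%E).
have m0 : 0 <= m by rewrite addr_ge0 ?sqrtr_ge0// mulr_ge0// ltW.
have -> : (m%:E = \int[mu]_(t in `[0%R, 1%R]) m%:E)%E.
  rewrite integral_cst//= lebesgue_measure_itv/= lte_fin ltr01.
  by rewrite oppr0 adde0 mule1.
have sm t : 0 < t < 1 -> speed G s t <= m.
  move=> t01; have /andP[t0 t1] := t01.
  have /psiP[cst stE] : (phi c @` dom c) (segment (phi c p) w t).
    by apply: I; rewrite !ltW.
  have C01 : C1_curve 0 1 s by exact: C1_curve_segment.
  have d : is_derive (t : R^o) (1 : R^o) (phi c \o s) w.
    rewrite -[w]scale1r.
    have tI : nbhs t `]0, 1[%classic.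
      by apply: open_nbhs_nbhs; split; [exact: interval_open|rewrite /= in_itv].
    apply: (has_diff_within_is_derive tI (L := fun h : R^o => h *: w)).
    have [lin H] := has_diff_within_segment (phi c p) w `]0, 1[%classic t.
    have sE x : `]0, 1[%classic x -> phi c (s x) = segment (phi c p) w x.
      rewrite /= in_itv/= => /andP[x0 x1].
      by have /psiP[] : (phi c @` dom c) (segment (phi c p) w x) by apply: I; rewrite !ltW.
    split=> // d d1; move: (H d d1); rewrite !near_withinE.
    apply: filterS => y + ty => /(_ ty).
    by rewrite /= -!sE//= in_itv.
  rewrite (speed_chart G (C1_curve_cvg C01 t01) cst d) /m.
  have iy : (phi c @` dom c) (segment (phi c p) w t) by apply: I; rewrite !ltW.
  have K0 : 0 < (n%:R ^+ 2 + 1 : R) by rewrite ltr_wpDl// sqr_ge0.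
  have dG : `|G c (s t) - G c p| <= e ^+ 2 / (n%:R ^+ 2 + 1).
    have := Hr2 (segment (phi c p) w t); rewrite -ball_normE/= /segment.
    rewrite opprD addrA subrr sub0r normrN normrZ ger0_norm ?(ltW t0)//.
    have -> : t * `|w| < r2 by rewrite (le_lt_trans _ w2)// ler_piMl// ltW.
    by move=> /(_ isT iy); rewrite phiK ?inE// => /ltW.
  have b1 : bilin (G c (s t)) w w <= bilin (G c p) w w + e ^+ 2 * `|w| ^+ 2.
    rewrite -lerBlDl -bilinBm (le_trans (ler_norm _))// (le_trans (bilin_le _ _ _))//.
    rewrite -mulrA -expr2 ler_wpM2r ?sqr_ge0//.
    rewrite (le_trans (ler_wpM2l (sqr_ge0 _) dG))// mulrCA ler_piMr ?sqr_ge0//.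
    by rewrite ler_pdivrMr// mul1r lerDl.
  set X := bilin (G c p) w w in b1 *.
  have X0 : 0 <= X by exact: gram_ge0.
  have ew : 0 <= e * `|w| by rewrite mulr_ge0// ltW.
  rewrite -(ler_pXn2r (n := 2)) ?nnegrE ?sqrtr_ge0 ?addr_ge0 ?sqrtr_ge0//.
  rewrite sqr_sqrtr ?gram_ge0// sqrrD sqr_sqrtr// exprMn.
  rewrite (le_trans b1)// -addrA lerD2l lerDr.
  by rewrite mulrn_wge0// mulr_ge0// sqrtr_ge0.
have ms : measurable_fun `[0 : R, 1] (EFin \o speed G s).
  by apply/measurable_EFinP; exact: measurable_speed.
have := @ae_ge0_le_integral _ _ _ mu `[0 : R, 1]%classic (measurable_itv _)
  (EFin \o speed G s) (cst m%:E).
apply => //.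
- by move=> x _; rewrite lee_fin speed_ge0.
(* At the endpoints the two-sided derivative depends on values outside [[0, 1]], so [sm] says
   nothing there. *)
exists [set 0; 1]; split.
- exact: measurableU.
- apply: countable_lebesgue_measure0; apply: finite_set_countable.
  by rewrite finite_setU; split; exact: finite_set1.
move=> t /= /not_implyP[]; rewrite in_itv/= => /andP[t0 t1] Ht.
apply: contrapT => /not_orP[t0' t1']; apply: Ht; rewrite lee_fin; apply: sm.
by rewrite !lt_neqAle t0 t1 !andbT eq_sym; apply/andP; split; exact/eqP.
Unshelve. all: end_near. Qed.

End chart_segments.

(** * Finiteness of the distance and coercivity of the metric tensor *)

Section rdist_metric.
Context (R : realType) (n : nat) (M : manifold R n) (G : riemannian_metric M).
Implicit Types (c : chart M) (p q : M).

Lemma rdist_cvg0 p (e : R) : 0 < e -> \forall q \near p, (rdist G p q < e%:E)%E.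
Proof.
move=> e0; have cp := dom_chart_at p.
have c0 : phi (chart_at p) q - phi (chart_at p) p @[q --> p] --> (0 : 'rV[R]_n).
  rewrite -[X in _ --> X](subrr (phi (chart_at p) p)).
  by apply: cvgB; [exact: phi_cvg|exact: cvg_cst].
have cb : bilin (G (chart_at p) p) (phi (chart_at p) q - phi (chart_at p) p)
    (phi (chart_at p) q - phi (chart_at p) p) @[q --> p] --> bilin (G (chart_at p) p) 0 0.
  by apply: bilin_cvg => //; exact: cvg_cst.
have cs := cvg_comp _ _ cb (@sqrt_continuous R _).
have c1 : 1 * `|phi (chart_at p) q - phi (chart_at p) p| @[q --> p] --> (1 * 0 : R).
  apply: cvgM; first exact: cvg_cst.
  have := cvg_norm c0; rewrite normr0; exact.
have b0 : bilin (G (chart_at p) p) 0 0 = 0 by rewrite /bilin !mul0mx mxE.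
have := cvgD cs c1; rewrite mulr0 addr0 b0 sqrtr0.
move=> /(_ _)/cvgrPdist_lt/(_ e e0); move: (rdist_near G cp ltr01).
apply: filterS2 => q /le_lt_trans h; rewrite sub0r normrN => /ltr_normlW ?.
by apply: h; rewrite lte_fin.
Qed.

Lemma rdistxx p : rdist G p p = 0%E.
Proof.
apply/le_anti; rewrite rdist_ge0 andbT; apply/lee_addgt0Pr => e e0.
by rewrite add0e ltW//; exact: nbhs_singleton (rdist_cvg0 p e0).
Qed.

(** Being at finite distance from [p] does not change within a ball of radius 1, so the set of such
    points is open and closed. *)
Lemma rdist_lty p q : connected [set: M] -> (rdist G p q < +oo)%E.
Proof.
move=> Mc; pose B := [set x | (rdist G p x < +oo)%E].
suff : B = [set: M] by move=> /seteqP[_ /(_ q I)].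
have tri x y : (rdist G p x < +oo -> rdist G x y < 1%:E -> rdist G p y < +oo)%E.
  move=> h1 h2; apply: le_lt_trans (rdist_triangle G p x y) _.
  by rewrite lte_add_pinfty// (lt_trans h2)// ltry.
apply: Mc.
- by exists p; rewrite /B/= rdistxx.
- exists B; last by rewrite setTI.
  rewrite openE => x Bx; apply: filterS (rdist_cvg0 x ltr01) => y.
  exact: tri.
- exists B; last by rewrite setTI.
  rewrite -[B]setCK closedC openE => x Bx.
  apply: filterS (rdist_cvg0 x ltr01) => y xy By; apply: Bx.
  by apply: tri By _; rewrite rdist_sym.
Qed.

(** The constant is the minimum of the form on the compact unit sphere, carried to all vectors by
    homogeneity. *)
Lemma bilin_coercive (A : 'M[R]_n) : (forall u, u != 0 -> 0 < bilin A u u) ->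
  exists2 m : R, 0 < m & forall u, m * `|u| ^+ 2 <= bilin A u u.
Proof.
move=> A0; pose S := [set u : 'rV[R]_n | `|u| = 1].
have cS : compact S.
  apply: bounded_closed_compact.
    by exists 1; split=> // x x1 u /= ->; exact: ltW.
  rewrite (_ : S = (fun u : 'rV[R]_n => `|u|) @^-1` [set 1])//.
  by apply: closed_comp => [u _|]; [exact: norm_continuous|exact: closed_eq].
(* The sphere is empty exactly in dimension 0, where every vector is zero. *)
have [[u0 Su0]|nS] := pselect (S !=set0); last first.
  exists 1 => // u; have [->|u0] := eqVneq u 0.
    by rewrite normr0 expr0n mulr0 /bilin !mul0mx mxE.
  exfalso; apply: nS; exists (`|u|^-1 *: u).
  by rewrite /S/= normrZ normfV normr_id mulVf// normr_eq0.
have cb : {within S, continuous (fun u => bilin A u u)}.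
  apply: continuous_subspaceT => u.
  have cA : A @[_ --> nbhs u] --> A by exact: cvg_cst.
  exact: (@bilin_cvg R n _ (nbhs u) (nbhs_filter u) (fun=> A) id id A u u cA).
have [u Su um] := compact_EVT_min (ex_intro _ u0 Su0) cS cb.
have u1 : `|u| = 1 by move: Su; rewrite inE.
exists (bilin A u u).
  by apply: A0; rewrite -normr_gt0 u1.
move=> v; have [->|v0] := eqVneq v 0.
  by rewrite normr0 expr0n mulr0 /bilin !mul0mx mxE.
have nv0 : `|v| != 0 by rewrite normr_eq0.
have : bilin A u u <= bilin A (`|v|^-1 *: v) (`|v|^-1 *: v).
  by apply: um; rewrite inE /S/= normrZ normfV normr_id mulVf.
by rewrite bilinZ exprVn ler_pdivlMl ?exprn_gt0 ?normr_gt0// mulrC.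
Qed.

Lemma gram_coercive c p : dom c p -> exists l r : R, [/\ 0 < l, 0 < r &
  forall q, dom c q -> `|phi c q - phi c p| <= r ->
    forall u, l * `|u| <= Num.sqrt (bilin (G c q) u u)].
Proof.
move=> cp.
have [m m0 Hm] := bilin_coercive (fun u => @gram_pos _ _ _ G c p u cp).
have K0 : 0 < (n%:R ^+ 2 + 1 : R) by rewrite ltr_wpDl// sqr_ge0.
have d0 : 0 < m / 2 / (n%:R ^+ 2 + 1) by rewrite !divr_gt0.
have /within_continuous_dist/(_ (phi c p) (ex_intro2 _ _ p cp erefl) _ d0) :=
  (gram_smooth G c 0).1.
move=> /nbhs_ballP[r /= r0 Hr].
(* The variation of the Gram matrix may consume half of the coercivity constant [m] at [p]; halving
   [r] puts the closed ball inside the open one given by continuity. *)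
exists (Num.sqrt (m / 2)), (r / 2); split; rewrite ?sqrtr_gt0 ?divr_gt0//.
move=> q cq qr u.
have dG : `|G c q - G c p| <= m / 2 / (n%:R ^+ 2 + 1).
  have := Hr (phi c q); rewrite -ball_normE/= distrC.
  have -> : `|phi c q - phi c p| < r by lra.
  by move=> /(_ isT (ex_intro2 _ _ q cq erefl)); rewrite !phiK ?inE// => /ltW.
have b1 : bilin (G c p) u u - bilin (G c q) u u <= m / 2 * `|u| ^+ 2.
  rewrite -bilinBm (le_trans (ler_norm _))// (le_trans (bilin_le _ _ _))// distrC.
  rewrite -mulrA -expr2 ler_wpM2r ?sqr_ge0//.
  rewrite (le_trans (ler_wpM2l (sqr_ge0 _) dG))// mulrCA ler_piMr ?divr_ge0 ?(ltW m0)//.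
  by rewrite ler_pdivrMr// mul1r lerDl.
have := Hm u => b2.
have -> : Num.sqrt (m / 2) * `|u| = Num.sqrt (m / 2 * `|u| ^+ 2).
  by rewrite [in RHS]sqrtrM ?divr_ge0 ?(ltW m0)// sqrtr_sqr normr_id.
by apply: ler_wsqrtr; lra.
Qed.

End rdist_metric.

(** * Lower bound on lengths and separation of points *)

Section rdist_definite.
Context (R : realType) (n : nat) (M : manifold R n) (G : riemannian_metric M).
Implicit Types (c : chart M) (p q : M).
Local Notation mu := (@lebesgue_measure R).

(** The cut-off at [r] lets the coordinate distance be extended by a constant outside the chart, so
    that it can be followed along curves that leave the chart and come back. *)
Definition chart_dist c p (r : R) (q : M) : R :=
  if `[< dom c q >] then Num.min r `|phi c q - phi c p| else r.

Lemma chart_distE c p r q : dom c q ->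
  chart_dist c p r q = Num.min r `|phi c q - phi c p|.
Proof. by move=> cq; rewrite /chart_dist asboolT. Qed.

Lemma chart_dist_le c p r q : chart_dist c p r q <= r.
Proof. by rewrite /chart_dist; case: ifP => _; rewrite ?ge_min lexx. Qed.

(* The closed coordinate ball is compact, hence closed in the Hausdorff M, so
   truncating the coordinate distance gives a continuous function on M. *)
Lemma chart_dist_continuous c p (r r1 : R) : dom c p -> r < r1 ->
  (forall x, half_space x -> `|x - phi c p| < r1 -> (phi c @` dom c) x) ->
  continuous (chart_dist c p r).
Proof.
move=> cp rr1 Hr1.
pose A := [set x | half_space x /\ `|x - phi c p| <= r].
have AI : A `<=` phi c @` dom c by move=> x [xh xr]; apply: Hr1 => //; exact: le_lt_trans rr1.
have cA : compact A.
  apply: bounded_closed_compact.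
    exists (`|phi c p| + r); split; first exact: num_real.
    move=> x xr u [_ ur] /=.
    rewrite -[u](subrK (phi c p)) (le_trans (ler_normD _ _))// addrC.
    by rewrite (le_trans _ (ltW xr))// lerD2l.
  rewrite (_ : A = @half_space R n `&`
    (fun u : 'rV[R]_n => `|u - phi c p|) @^-1` [set x | x <= r])//.
  apply: closedI; last first.
    apply: closed_comp => [u _|]; last exact: closed_le.
    have H : x - phi c p @[x --> u] --> u - phi c p.
      have h1 : x @[x --> nbhs u] --> u by exact: cvg_id.
      have h2 : phi c p @[_ --> nbhs u] --> phi c p by exact: cvg_cst.
      exact: (@cvgB _ _ _ (nbhs u) (nbhs_filter u) id _ _ _ h1 h2).
    exact: (@cvg_norm _ _ _ (nbhs u) (nbhs_filter u) _ _ H).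
  rewrite (_ : @half_space R n =
      \bigcap_(i in [set i : 'I_n | val i = 0%N])
        ((fun u : 'rV[R]_n => u ord0 i) @^-1` [set x | 0 <= x])).
    apply: closed_bigI => i _.
    apply: closed_comp => [u _|]; last exact: closed_ge.
    exact: coord_continuous.
  by apply/seteqP; split.
pose K := psi c @` A.
have cK : closed K.
  apply: compact_closed; first exact: manifold_hausdorff.
  apply: continuous_compact => //.
  exact: continuous_subspaceW AI (@psi_continuous _ _ M c).
move=> q; have [cq|ncq] := pselect (dom c q).
  have E : \forall x \near q, Num.min r `|phi c x - phi c p| = chart_dist c p r x.
    have : nbhs q (dom c) by apply: open_nbhs_nbhs; split=> //; exact: dom_open.
    by apply: filterS => x cx; rewrite chart_distE.
  rewrite /continuous_at -(nbhs_singleton E).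
  apply: (cvg_trans (near_eq_cvg E)).
  apply: (@continuous_min _ M (cst r) (fun x => `|phi c x - phi c p|) q).
    exact: cvg_cst.
  by apply: cvg_norm; apply: cvgB; [exact: phi_cvg|exact: cvg_cst].
have E : \forall x \near q, cst r x = chart_dist c p r x.
  have : nbhs q (~` K).
    apply: open_nbhs_nbhs; split; first exact: closed_openC.
    by move=> [x /AI /psiP[cx _] xq]; apply: ncq; rewrite -xq.
  apply: filterS => x nKx; rewrite /chart_dist; case: asboolP => // cx.
  rewrite /cst/= min_l// leNgt; apply/negP => xr; apply: nKx.
  exists (phi c x); last by rewrite phiK// inE.
  by split; [exact: phi_half_space|exact: ltW].
rewrite /continuous_at -(nbhs_singleton E).
by apply: (cvg_trans (near_eq_cvg E)); exact: cvg_cst.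
Qed.

(** [growth_le] compares [l] times the truncated coordinate distance with arc length. Inside the
    ball the coordinate distance grows at most at the coordinate speed, which coercivity bounds by
    the Riemannian speed divided by [l]. *)
Lemma curve_length_ge c p (r r1 l : R) (s : R -> M) : dom c p ->
  0 <= l -> r < r1 ->
  (forall x, half_space x -> `|x - phi c p| < r1 -> (phi c @` dom c) x) ->
  (forall q, dom c q -> `|phi c q - phi c p| <= r ->
    forall u, l * `|u| <= Num.sqrt (bilin (G c q) u u)) ->
  piecewise_C1 s ->
  ((l * (chart_dist c p r (s 1%R) - chart_dist c p r (s 0%R)))%:E
    <= curve_length G s)%E.
Proof.
move=> cp l0 rr1 Hr1 Hl Cs.
(* Finite total length makes arc length real-valued, as [growth_le] requires. *)
have [lf|] := ltP (curve_length G s) +oo%E; last by apply: le_trans; exact: leey.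
have ms := measurable_speed G Cs.
have mE : measurable_fun `[0 : R, 1] (EFin \o speed G s) by apply/measurable_EFinP.
pose I t := (\int[mu]_(x in `[0%R, t]) (speed G s x)%:E)%E.
have I0 t : (0 <= I t)%E.
  by apply: integral_ge0 => x _; rewrite lee_fin speed_ge0.
have Ile t u : 0 <= t -> t <= u -> u <= 1 -> (I t <= I u)%E.
  move=> t0 tu u1; apply: ge0_subset_integral => //.
  - apply: measurable_funS mE => //; apply: subset_itvl; rewrite bnd_simp.
    exact: u1.
  - by move=> x _; rewrite lee_fin speed_ge0.
  - by apply: subset_itvl; rewrite bnd_simp.
have Ifin t : 0 <= t -> t <= 1 -> I t \is a fin_num.
  move=> t0 t1; rewrite ge0_fin_numE// (le_lt_trans _ lf)//.
  exact: (Ile t 1).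
pose L t := fine (I t).
pose f t := l * chart_dist c p r (s t).
suff : f 1 - f 0 <= L 1 - L 0.
  rewrite /f -mulrBr => h.
  have -> : curve_length G s = (L 1)%:E by rewrite fineK// Ifin.
  rewrite lee_fin (le_trans h)// gerBl.
  exact: fine_ge0.
have [B HB] := piecewise_C1_regular Cs.
apply: (@growth_le R B f L 0 1) => //.
- have sc := piecewise_C1_continuous Cs.
  have dc := chart_dist_continuous cp rr1 Hr1.
  have fc : continuous (fun q => l * chart_dist c p r q).
    by move=> q; apply: cvgM; [exact: cvg_cst|exact: dc].
  apply/subspace_continuousP => x xI.
  have /subspace_continuousP/(_ x xI) sx := sc.
  exact: cvg_comp sx (fc (s x)).
- move=> x y; rewrite !in_itv/= => /andP[x0 x1] /andP[y0 y1] xy.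
  by rewrite fine_le// ?Ifin// Ile.
move=> t t01 tB e e0.
have [a [b [tab Cab]]] := HB t t01 tB.
have st := C1_curve_cvg Cab tab.
have /andP[t0 t1] := t01.
(* Once the cut-off is reached, [f] is at its maximum while arc length does not decrease. *)
have [rle|rgt] := leP r (chart_dist c p r (s t)).
  near=> x.
  have tx : t < x by near: x; exact: nbhs_right_gt.
  have x1 : x < 1 by near: x; exact: nbhs_right_lt.
  have : L t <= L x by rewrite fine_le ?Ifin ?Ile// ltW// (lt_trans t0).
  have : f x <= f t.
    by rewrite ler_wpM2l// (le_trans _ rle)// chart_dist_le.
  have : 0 <= e * (x - t) by rewrite mulr_ge0 ?subr_ge0// ltW.
  lra.
have ct : dom c (s t).
  by move: rgt; rewrite /chart_dist; case: asboolP => //; rewrite ltxx.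
have [w [wt /nbhs_singleton[_ _ dw]]] := C1_curve_derive Cab tab ct.
have ut : chart_dist c p r (s t) = `|phi c (s t) - phi c p|.
  by move: rgt; rewrite chart_distE// gt_min ltxx/= => h; rewrite min_r// ltW.
(* Half of [e] pays for the error of the linear approximation, multiplied by [l] which may vanish;
   the other half pays for the variation of the speed after [t]. *)
have e1 : 0 < e / 2 / (l + 1) by rewrite !divr_gt0// ltr_wpDl.
have e2 : 0 < e / 2 by rewrite divr_gt0.
have lw : l * `|w t| <= speed G s t.
  by rewrite (speed_chart G st ct dw); apply: Hl => //; rewrite -ut ltW.
have /cvgrPdist_lt/(_ _ e2)/nbhs_ballP[d /= d0 Hd] := speed_cvg (G := G) Cab tab.
have [_ /(_ _ e1)] := is_derive_has_diff_within setT dw.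
rewrite near_withinE => Hw.
have sct : \forall x \near t, dom c (s x).
  have : nbhs (s t) (dom c) by apply: open_nbhs_nbhs; split=> //; exact: dom_open.
  by move=> /st.
near=> x.
have tx : t < x by near: x; exact: nbhs_right_gt.
have x1 : x < 1 by near: x; exact: nbhs_right_lt.
have xtd : x < t + d by near: x; apply: nbhs_right_lt; rewrite ltrDl.
have xt0 : 0 < x - t by rewrite subr_gt0.
have cx : dom c (s x).
  by near: x; exact: cvg_within.
have hw : `|phi c (s x) - phi c (s t) - (x - t) *: w t| <= e / 2 / (l + 1) * `|x - t|.
  have : [set: R] x by [].
  by near: x; exact: cvg_within.
have hu : `|phi c (s x) - phi c (s t)| <= (`|w t| + e / 2 / (l + 1)) * (x - t).
  rewrite -[X in `|X|](subrK ((x - t) *: w t)) (le_trans (ler_normD _ _))//.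
  move: hw; rewrite normrZ (gtr0_norm xt0); nra.
have hf : chart_dist c p r (s x) - chart_dist c p r (s t) <=
    `|phi c (s x) - phi c (s t)|.
  rewrite ut lerBlDr chart_distE// ge_min; apply/orP; right.
  by rewrite (le_trans _ (ler_normD _ _))// addrA subrK.
(* The maximum with 0 is there because [integral_itv_growth] takes a nonnegative lower bound. *)
pose m := Num.max 0 (speed G s t - e / 2).
have m0 : 0 <= m by rewrite le_max lexx.
have mm : speed G s t - e / 2 <= m by rewrite le_max lexx orbT.
have hI : m * (x - t) <= L x - L t.
  have ms0x : measurable_fun `[0 : R, x] (speed G s).
    by apply: measurable_funS ms => //; apply: subset_itvl; rewrite bnd_simp ltW.
  have mle y : t < y <= x -> m <= speed G s y.
    move=> /andP[ty yx]; rewrite ge_max speed_ge0/=.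
    have yd : ball t d y.
      rewrite /ball/= ltr_distl ltrBlDr (le_lt_trans yx xtd)/=.
      by rewrite (lt_trans ty)// ltrDl.
    have : `|speed G s t - speed G s y| < e / 2 by exact: Hd yd.
    by rewrite ltr_distl => /andP[_ yt]; rewrite lerBlDr ltW.
  have tx0 : 0 <= t <= x by rewrite !ltW.
  have : (I t + (m * (x - t))%:E <= I x)%E.
    exact: integral_itv_growth tx0 ms0x (speed_ge0 G s) m0 mle.
  have It : I t = (L t)%:E by rewrite fineK// Ifin// ltW.
  have Ix : I x = (L x)%:E.
    by apply/esym/fineK/Ifin; [exact: ltW (lt_trans t0 tx)|exact: ltW].
  by rewrite It Ix -EFinD lee_fin -lerBrDl.
have : f x - f t <= l * ((`|w t| + e / 2 / (l + 1)) * (x - t)).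
  by rewrite /f -mulrBr ler_wpM2l// (le_trans hf).
have le1 : l * (e / 2 / (l + 1)) <= e / 2.
  by rewrite mulrCA ler_piMr ?(ltW e2)// ler_pdivrMr ?ltr_wpDl// mul1r lerDl.
have : l * ((`|w t| + e / 2 / (l + 1)) * (x - t)) <= (speed G s t + e / 2) * (x - t).
  by rewrite mulrA ler_wpM2r ?(ltW xt0)// mulrDr lerD.
have : (speed G s t - e / 2) * (x - t) <= m * (x - t) by rewrite ler_wpM2r// ltW.
have -> : (speed G s t + e / 2) * (x - t) =
  (speed G s t - e / 2) * (x - t) + e * (x - t) by field.
lra.
Unshelve. all: end_near. Qed.

Lemma rdist_eq0 p q : rdist G p q = 0%E -> p = q.
Proof.
move=> pq0; apply: contrapT => pq; have cp := dom_chart_at p.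
set c := chart_at p in cp.
have [r1 r10 Hr1] := chart_ball cp.
have [l [r2 [l0 r20 Hl]]] := gram_coercive G cp.
(* Strictly below [r1] so that the closed ball lies in the image of the chart, and at most [r2] for
   coercivity. *)
pose r := Num.min (r1 / 2) r2.
have r0 : 0 < r by rewrite lt_min divr_gt0.
have rr1 : r < r1 by rewrite gt_min; apply/orP; left; lra.
have rr2 : r <= r2 by rewrite ge_min lexx orbT.
have dp : chart_dist c p r p = 0.
  by rewrite chart_distE// subrr normr0 min_r// ltW.
have dq : 0 < chart_dist c p r q.
  have [cq|ncq] := pselect (dom c q); last by rewrite /chart_dist asboolF.
  rewrite chart_distE// lt_min r0 normr_gt0 subr_eq0; apply/eqP => pqE.
  by apply: pq; rewrite -(@phiK _ _ M c p) ?inE// -(@phiK _ _ M c q) ?inE// pqE.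
have : ((l * chart_dist c p r q)%:E <= rdist G p q)%E.
  apply: le_ereal_inf_tmp => _ [s [Cs s0 s1] <-].
  have Hl' x : dom c x -> `|phi c x - phi c p| <= r ->
      forall u, l * `|u| <= Num.sqrt (bilin (G c x) u u).
    by move=> cx xr; apply: Hl => //; exact: le_trans rr2.
  have := curve_length_ge cp (ltW l0) rr1 Hr1 Hl' Cs.
  by rewrite s0 s1 dp subr0.
by rewrite pq0 lee_fin leNgt mulr_gt0.
Qed.

End rdist_definite.

(** * Filippov orbits *)

Section orbits.
Context (R : realType) (n : nat) (M : manifold R n.+1).
Context (G : riemannian_metric M) (r : nat) (F : filippov_system M r).
Let h : M -> R := hfun F.
Definition field_bound : R := Num.max 0 (fine (Fnorm G F)).

Let C := field_bound.

Lemma field_bound_ge0 : 0 <= field_bound. Proof. by rewrite le_max lexx. Qed.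

Context (F_bounded : bounded_system G F).

Lemma tnorm_Fval p v : Fval F p v -> tnorm G p v <= C.
Proof.
move=> Fv.
have le : ((tnorm G p v)%:E <= Fnorm G F)%E.
  by apply: ereal_sup_ubound; exists p => //; exists v.
have fin : Fnorm G F \is a fin_num.
  by rewrite fin_numElt (lt_le_trans _ le) ?ltNyr//=.
by rewrite /C /field_bound le_max; apply/orP; right; rewrite -lee_fin fineK.
Qed.

Lemma bilin_tnorm p v : tnorm G p v <= C -> bilin (G (chart_at p) p) v v <= C ^+ 2.
Proof.
move=> vC; rewrite -(sqr_sqrtr (gram_ge0 G v (dom_chart_at p))).
by rewrite ler_pXn2r ?nnegrE ?sqrtr_ge0 ?field_bound_ge0.
Qed.

Lemma Fval_plus p : 0 < h p -> Fval F p (Fplus F (chart_at p) p).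
Proof.
move=> hp; exists 1; first by rewrite /sgn_multi /mkset (gt_eqF hp) gtr0_sg.
by apply/rowP => i; rewrite !mxE; field.
Qed.

Lemma Fval_minus p : h p < 0 -> Fval F p (Fminus F (chart_at p) p).
Proof.
move=> hp; exists (-1); first by rewrite /sgn_multi /mkset (lt_eqF hp) ltr0_sg.
by apply/rowP => i; rewrite !mxE; field.
Qed.

Lemma Fval_sliding p : Sigma_s G F p -> Fval F p (Fsliding G F (chart_at p) p).
Proof.
move=> [hp ab]; rewrite /Fsliding.
set a := lie G F (Fminus F) p in ab *; set b := lie G F (Fplus F) p in ab *.
set X := Fplus F _ p; set Y := Fminus F _ p.
have ab0 : a - b != 0.
  by apply/eqP => /subr0_eq E; move: ab; rewrite E -expr2 ltNge sqr_ge0.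
(* This [s] solves [(1 + s) / 2 = a / (a - b)], the weight of [F+] in the sliding field; [a * b < 0]
   gives [|a + b| <= |a - b|], so [s] lies in [[-1, 1]]. *)
exists ((a + b) / (a - b)).
  have hp0 : hfun F p = 0 by [].
  rewrite /sgn_multi /mkset hp0 eqxx -ler_norml normf_div ler_pdivrMr ?normr_gt0//.
  by rewrite mul1r -(ler_pXn2r (n := 2)) ?nnegrE// !real_normK ?num_real//; nra.
apply/rowP => i; rewrite !mxE.
by field.
Qed.

(** The chart is arbitrary because the extension to a tangency point is a limit taken in the chart
    at that point, while the bound by the norm of [F] is read in the chart chosen at each nearby
    point. *)
Lemma Fsliding_bound c p : Sigma_s G F p -> dom c p ->
  bilin (G c p) (Fsliding G F c p) (Fsliding G F c p) <= C ^+ 2.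
Proof.
move=> sp cp; have cp0 := dom_chart_at p.
have [L dL] := transition_diff_exists cp cp0.
rewrite -(gram_compat G cp cp0 dL).
have -> : L (Fsliding G F c p) = Fsliding G F (chart_at p) p.
  rewrite /Fsliding (linear_funZ _ _ dL.1) (linear_funB _ _ dL.1).
  rewrite !(linear_funZ _ _ dL.1).
  by rewrite -(vf_compat (Fplus F) cp cp0 dL) -(vf_compat (Fminus F) cp cp0 dL).
exact/bilin_tnorm/tnorm_Fval/Fval_sliding.
Qed.

Lemma sliding_value_bound p v : sliding_value G F p v ->
  bilin (G (chart_at p) p) v v <= C ^+ 2.
Proof.
move=> [[sp ->]|[_ clp cv]]; first exact: Fsliding_bound (dom_chart_at p).
set c := chart_at p in cv *; have cp : dom c p by exact: dom_chart_at.
rewrite leNgt; apply/negP => Cv.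
pose FF := within_filter (Sigma_s G F) (nbhs_filter p).
have cG : G c q @[q --> within (Sigma_s G F) (nbhs p)] --> G c p.
  by apply: cvg_within_filter; exact: gram_cvg.
have := @bilin_cvg _ _ _ _ FF _ _ _ _ _ _ cG cv cv.
have d0 : 0 < bilin (G c p) v v - C ^+ 2 by rewrite subr_gt0.
move=> /cvgrPdist_lt/(_ _ d0); rewrite near_withinE => H.
have pc : nbhs p (dom c) by apply: open_nbhs_nbhs; split=> //; exact: dom_open.
(* Adherence provides a sliding point so close to [p] that the assumed excess over [C ^ 2] already
   appears there. *)
have [q [sq [cq]]] := clp _ (filterI pc H).
move=> /(_ sq); rewrite ltr_distl => /andP[_].
by have := Fsliding_bound sq cq; lra.
Qed.

Lemma orbit_velocity g : orbit_space G F g ->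
  continuous g /\ exists B : set R,
    (forall a b, finite_set (B `&` `[a, b])) /\
    forall t, ~ B t -> exists v, has_velocity g t v /\
      bilin (G (chart_at (g t)) (g t)) v v <= C ^+ 2.
Proof.
move=> [[_ _ gc [B [_ Bfin Bpiece _]]] _]; split.
  move=> t U gU; have /subspace_continuousP/(_ t I) gt := gc.
  have H : \forall x \near t, [set: R] x -> U (g x) := gt U gU.
  by apply: filterS H => x; apply.
exists B; split=> [a b|t Bt]; first exact: Bfin.
have [e e0 He] : exists2 e : R, 0 < e & `]t - e, t + e[ `<=` setT `\` B.
  have /finite_seqP[s sE] := Bfin (t - 1) (t + 1) I I.
  have [e e0 He] := finite_gap s t.
  (* The gap [e] only concerns gluing times in [[t - 1, t + 1]], where they are finitely many. *)
  exists (Num.min e 1); first by rewrite lt_min e0 ltr01.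
  move=> x /=; rewrite in_itv/= => xt; split=> // Bx.
  have xt1 : `|x - t| < Num.min e 1 by rewrite ltr_distl.
  move: xt1; rewrite lt_min => /andP[xe x1].
  have xs : x \in s.
    have : (B `&` `[t - 1, t + 1]) x.
      split=> //=; rewrite in_itv/= -ler_distl; exact: ltW.
    by rewrite sE.
  have := He x xs; rewrite leNgt xe => H.
  by apply: Bt; have [<-//|/H] := eqVneq x t.
have te : t - e < t + e by rewrite ltrD2l gtrN.
have tt : t - e < t < t + e by rewrite ltrDl ltrBlDr ltrDl e0.
have [H|H|H] := Bpiece _ _ te He; have := H t tt.
- move=> [hp dv]; exists (Fplus F (chart_at (g t)) (g t)); split=> //.
  exact/bilin_tnorm/tnorm_Fval/Fval_plus.
- move=> [hp dv]; exists (Fminus F (chart_at (g t)) (g t)); split=> //.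
  exact/bilin_tnorm/tnorm_Fval/Fval_minus.
- by move=> [v sv dv]; exists v; split=> //; exact: sliding_value_bound.
Qed.

End orbits.

(** * Curves of bounded velocity are Lipschitz *)

Section real_distance.
Context (R : realType) (n : nat) (M : manifold R n) (G : riemannian_metric M).
Context (Mc : connected [set: M]).
Implicit Types (p q z : M).

Let d p q : R := fine (rdist G p q).

Lemma rdist_fineE p q : rdist G p q = (fine (rdist G p q))%:E.
Proof. by rewrite fineK// ge0_fin_numE ?rdist_ge0// rdist_lty. Qed.

Let dE p q : rdist G p q = (d p q)%:E. Proof. exact: rdist_fineE. Qed.

Let d_sym p q : d p q = d q p. Proof. by rewrite /d rdist_sym. Qed.

Let d_tri p q z : d p z <= d p q + d q z.
Proof. by rewrite -lee_fin EFinD -!dE rdist_triangle. Qed.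

Let d_near p (e : R) : 0 < e -> \forall q \near p, d p q < e.
Proof. by move=> /(rdist_cvg0 G p); apply: filterS => q; rewrite dE lte_fin. Qed.

Lemma rdist_continuous (g0 g1 : R -> M) : continuous g0 -> continuous g1 ->
  continuous (fun t => fine (rdist G (g0 t) (g1 t))).
Proof.
move=> c0 c1 t; apply/cvgrPdist_lt => e e0.
have e2 : 0 < e / 2 by rewrite divr_gt0.
have h0 : \forall s \near t, d (g0 t) (g0 s) < e / 2.
  exact: (c0 t _ (d_near (g0 t) e2)).
have h1 : \forall s \near t, d (g1 t) (g1 s) < e / 2.
  exact: (c1 t _ (d_near (g1 t) e2)).
move: h0 h1; apply: filterS2 => s h0 h1; rewrite -!/(d _ _).
have := d_tri (g0 t) (g0 s) (g1 t); have := d_tri (g0 s) (g1 s) (g1 t).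
have := d_tri (g0 s) (g0 t) (g1 s); have := d_tri (g0 t) (g1 t) (g1 s).
rewrite (d_sym (g1 s) (g1 t)) (d_sym (g0 s) (g0 t)) ltr_distl => *.
by apply/andP; split; lra.
Qed.

(** By the triangle inequality the increments of the distance to [g a] are at most the distance from
    [g t] to [g x]. [rdist_near] bounds the latter by [x - t] times the norm of the difference
    quotient [k x], which tends to the norm of the velocity. *)
Lemma rdist_lipschitz (C : R) (B : set R) (g : R -> M) : 0 <= C ->
  continuous g -> (forall a b, finite_set (B `&` `[a, b])) ->
  (forall t, ~ B t -> exists v, is_derive (t : R^o) (1 : R^o) (phi (chart_at (g t)) \o g) v /\
    bilin (G (chart_at (g t)) (g t)) v v <= C ^+ 2) ->
  forall a b, (rdist G (g a) (g b) <= (C * `|b - a|)%:E)%E.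
Proof.
move=> C0 gc Bfin gv a b; rewrite dE lee_fin.
wlog ab : a b / a <= b.
  by move=> H; have [/H//|/ltW/H] := leP a b; rewrite d_sym distrC.
rewrite ger0_norm ?subr_ge0//.
have /finite_seqP[s sE] := Bfin a b.
have aa : d (g a) (g a) = 0 by rewrite /d rdistxx.
suff : d (g a) (g b) - d (g a) (g a) <= C * b - C * a.
  by rewrite aa subr0 -mulrBr.
apply: (@growth_le R s (fun t => d (g a) (g t)) (fun t => C * t)) => //.
- apply: continuous_subspaceT.
  by apply: (@rdist_continuous (fun=> g a) g) => // ?; exact: cvg_cst.
- by move=> x y _ _ xy; rewrite ler_wpM2l.
move=> t /andP[at_ tb] ts e e0.
have [v [dv bv]] : exists v, is_derive (t : R^o) (1 : R^o) (phi (chart_at (g t)) \o g) v /\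
    bilin (G (chart_at (g t)) (g t)) v v <= C ^+ 2.
  apply: gv => Bt; move/negP : ts; apply.
  have : (B `&` `[a, b]) t by split=> //=; rewrite in_itv/= !ltW.
  by rewrite sE.
set c := chart_at (g t) in dv bv.
have ct : dom c (g t) by exact: dom_chart_at.
pose w x := phi c (g x) - phi c (g t).
pose k x := (x - t)^-1 *: w x.
have kv : k x @[x --> t^'+] --> v.
  apply/cvgrPdist_le => e1 e10.
  have [_ /(_ _ e10)] := is_derive_has_diff_within setT dv.
  rewrite near_withinE => H; near=> x.
  have xt : 0 < x - t by rewrite subr_gt0; near: x; exact: nbhs_right_gt.
  have : [set: R] x by [].
  have : [set: R] x -> `|(phi c \o g) x - (phi c \o g) t - (x - t) *: v| <= e1 * `|x - t|.
    by near: x; exact: cvg_within.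
  move=> /[apply]; rewrite /= -/(w x) (gtr0_norm xt).
  have -> : w x - (x - t) *: v = - ((x - t) *: (v - k x)).
    by rewrite /k scalerBr scalerA divff ?gt_eqF// scale1r opprB.
  by rewrite normrN normrZ (gtr0_norm xt) mulrC ler_pM2r.
(* Since [|k x|] is eventually at most [|v| + 1], the error term of [rdist_near] costs at most
   [e / 2] per unit of time. *)
have e1 : 0 < e / 2 / (`|v| + 1) by rewrite !divr_gt0// ltr_wpDl.
have e2 : 0 < e / 2 by rewrite divr_gt0.
have sk : \forall x \near t^'+, Num.sqrt (bilin (G c (g t)) (k x) (k x)) <= C + e / 2.
  have cA : G c (g t) @[_ --> t^'+] --> G c (g t) by exact: cvg_cst.
  have cb : Num.sqrt (bilin (G c (g t)) (k x) (k x)) @[x --> t^'+] -->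
      Num.sqrt (bilin (G c (g t)) v v).
    exact: (cvg_comp _ _ (bilin_cvg _ cA kv kv) (@sqrt_continuous R _)).
  have /cvgrPdist_lt/(_ _ e2) := cb.
  apply: filterS => x /=; rewrite ltr_distlC => /andP[_ /ltW /le_trans]; apply.
  by rewrite lerD2r -[leRHS](ger0_norm C0) -sqrtr_sqr ler_wsqrtr.
have nk : \forall x \near t^'+, `|k x| <= `|v| + 1.
  have nv : `|k x| @[x --> t^'+] --> `|v| by exact: cvg_norm.
  have /cvgrPdist_lt/(_ _ ltr01) := nv.
  by apply: filterS => x /=; rewrite ltr_distlC => /andP[_ /ltW].
have dn : \forall x \near t^'+, (rdist G (g t) (g x) <=
    (Num.sqrt (bilin (G c (g t)) (w x) (w x)) + e / 2 / (`|v| + 1) * `|w x|)%:E)%E.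
  by apply: cvg_within; exact: (gc t _ (rdist_near G ct e1)).
near=> x.
have xt : 0 < x - t by rewrite subr_gt0; near: x; exact: nbhs_right_gt.
have h1 : Num.sqrt (bilin (G c (g t)) (k x) (k x)) <= C + e / 2 by near: x.
have h2 : `|k x| <= `|v| + 1 by near: x.
have h3 : (rdist G (g t) (g x) <=
    (Num.sqrt (bilin (G c (g t)) (w x) (w x)) + e / 2 / (`|v| + 1) * `|w x|)%:E)%E.
  by near: x.
have wk : w x = (x - t) *: k x by rewrite /k scalerA divff ?gt_eqF// scale1r.
move: h3; rewrite dE lee_fin wk bilinZ sqrtrM ?sqr_ge0// sqrtr_sqr normrZ (gtr0_norm xt) => h3.
have h4 : e / 2 / (`|v| + 1) * `|k x| <= e / 2.
  by rewrite (le_trans (ler_wpM2l (ltW e1) h2))// divfK//.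
have h5 : (x - t) * Num.sqrt (bilin (G c (g t)) (k x) (k x)) <= (x - t) * (C + e / 2).
  by rewrite ler_wpM2l// ltW.
have h6 : (x - t) * (e / 2 / (`|v| + 1) * `|k x|) <= (x - t) * (e / 2).
  by rewrite ler_wpM2l// ltW.
have h7 := d_tri (g a) (g t) (g x).
rewrite mulrCA in h3.
have h8 : d (g t) (g x) <= (x - t) * (C + e / 2) + (x - t) * (e / 2).
  by rewrite (le_trans h3)// lerD.
have -> : C * x - C * t + e * (x - t) = (x - t) * (C + e / 2) + (x - t) * (e / 2) by field.
by rewrite lerBlDl (le_trans h7)// lerD2l.
Unshelve. all: end_near. Qed.

End real_distance.

(** * The integral distance *)

Section integral_distance.
Context (R : realType).
Local Notation mu := (@lebesgue_measure R).

Lemma esum_le_scale (I : choiceType) (k : R) (a : I -> \bar R) : 0 <= k ->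
  (forall i, 0 <= a i)%E ->
  (\esum_(i in [set: I]) (k%:E * a i) <= k%:E * \esum_(i in [set: I]) a i)%E.
Proof.
move=> k0 a0; apply: ge_ereal_sup => _ [X XI <-].
rewrite -ge0_mule_fsumr//; apply: lee_pmul => //.
  by apply: fsume_ge0 => i _.
by apply: ereal_sup_ubound; exists X.
Qed.

Let nat_weights (A : R) (a : nat -> R) : 0 <= A ->
  (forall k, 0 <= a k <= A * (2 ^- k * (k%:R + 1))) ->
  (\esum_(k in [set: nat]) (a k)%:E <= (4 * A)%:E)%E.
Proof.
move=> A0 aA; rewrite -nneseries_esumT; last first.
  by move=> k; rewrite lee_fin; have /andP[] := aA k.
apply: lime_le.
  by apply: is_cvg_nneseries => k _ _; rewrite lee_fin; have /andP[] := aA k.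
apply: nearW => m.
(* sum_(k < m) (k + 1) / 2^k = 4 - (2m + 4) / 2^m *)
suff : (\sum_(0 <= k < m) (a k)%:E <= (A * (4 - 2 ^- m * (2 * m%:R + 4)))%:E)%E.
  move=> /le_trans; apply; rewrite lee_fin [leRHS]mulrC ler_wpM2l// gerBl.
  by rewrite mulr_ge0// ?invr_ge0 ?exprn_ge0// addr_ge0// mulr_ge0.
elim: m => [|m IH].
  by rewrite big_nil lee_fin expr0 invr1 mul1r mulr0 add0r subrr mulr0.
rewrite big_nat_recr//=; apply: le_trans (leeD IH (_ : _ <= (A * (2 ^- m * (m%:R + 1)))%:E)%E) _.
  by rewrite lee_fin; have /andP[] := aA m.
rewrite -EFinD lee_fin -mulrDr ler_wpM2l// exprS invfM -natr1.
have : 0 < (2 : R) ^- m by rewrite invr_gt0 exprn_gt0.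
set q := 2 ^- m; set x := m%:R => q0.
by rewrite le_eqVlt; apply/orP; left; apply/eqP; field.
Qed.

(** The nonnegative and the negative integers contribute at most [4 * A] each. *)
Lemma esum_int_weights (A : R) (a : int -> \bar R) : 0 <= A ->
  (forall i, 0 <= a i <= (A * (2 ^- `|i|%N * (`|i|%N%:R + 1)))%:E)%E ->
  (\esum_(i in [set: int]) a i <= (8 * A)%:E)%E.
Proof.
move=> A0 aA.
pose b (i : int) := fine (a i).
have aE i : a i = (b i)%:E.
  have /andP[h1 h2] := aA i.
  by rewrite /b fineK// ge0_fin_numE// (le_lt_trans h2)// ltry.
have bA i : 0 <= b i <= A * (2 ^- `|i|%N * (`|i|%N%:R + 1)).
  by have := aA i; rewrite aE !lee_fin.
rewrite (esumID [set Posz k | k in [set: nat]]); last by move=> i _; have /andP[] := aA i.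
rewrite !setTI (_ : ~` _ = [set Negz k | k in [set: nat]]); last first.
  apply/seteqP; split => [[k|k]/=|_ [k _ <-] [k' _]//].
    by move=> H; exfalso; apply: H; exists k.
  by exists k.
rewrite !esum_image; last 2 first.
- by move=> x y _ _ [].
- by move=> x y _ _ [].
rewrite (_ : 8 * A = 4 * A + 4 * A); last by ring.
rewrite EFinD; apply: leeD.
  under eq_esum do rewrite aE.
  by apply: nat_weights => // k; exact: bA (Posz k).
under eq_esum do rewrite aE.
(* [Negz k] has absolute value [k + 1], and [(k + 2) / 2 ^ (k + 1) <= (k + 1) / 2 ^ k]. *)
apply: nat_weights => // k; have /andP[-> /le_trans] := bA (Negz k); apply.
rewrite ler_wpM2l//= exprS invfM -[k.+1%:R]natr1.
have : 0 < (2 : R) ^- k by rewrite invr_gt0 exprn_gt0.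
have : 0 <= (k%:R : R) by [].
set q := 2 ^- k; set x := k%:R => x0 q0.
have : 0 <= q * x by rewrite mulr_ge0// ltW.
lra.
Qed.

End integral_distance.

Section lipschitz_curves.
Context (R : realType) (n : nat) (M : manifold R n.+1) (G : riemannian_metric M).
Context (Mc : connected [set: M]).
Implicit Types (x y z : R -> M).
Local Notation mu := (@lebesgue_measure R).

Let D x y t : R := fine (rdist G (x t) (y t)).

Let DE x y t : rdist G (x t) (y t) = (D x y t)%:E.
Proof. exact: rdist_fineE. Qed.

Let D_ge0 x y t : 0 <= D x y t. Proof. exact/fine_ge0/rdist_ge0. Qed.

Let I x y (i : int) : \bar R :=
  (\int[mu]_(t in `[i%:~R : R, (i + 1)%:~R : R]) rdist G (x t) (y t))%E.

Let I_ge0 x y i : (0 <= I x y i)%E.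
Proof. by apply: integral_ge0 => t _; exact: rdist_ge0. Qed.

Let w_ge0 (i : int) : 0 <= 2 ^- `|i|%N :> R.
Proof. by rewrite invr_ge0 exprn_ge0. Qed.

Let wI_ge0 x y i : (0 <= (2 ^- `|i|%N : R)%:E * I x y i)%E.
Proof. by rewrite mule_ge0// lee_fin. Qed.

Let measurable_rdist x y (S : set R) : continuous x -> continuous y ->
  measurable S -> measurable_fun S (fun t => rdist G (x t) (y t)).
Proof.
move=> cx cy mS; under eq_fun do rewrite DE.
apply/measurable_EFinP; apply: measurable_funTS.
by apply: continuous_measurable_fun; exact: rdist_continuous.
Qed.

Let integral_le (a b K : R) x y : a <= b -> continuous x -> continuous y -> 0 <= K ->
  (forall t, a <= t <= b -> (rdist G (x t) (y t) <= K%:E)%E) ->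
  (\int[mu]_(t in `[a, b]) rdist G (x t) (y t) <= (K * (b - a))%:E)%E.
Proof.
move=> ab cx cy K0 H.
have -> : ((K * (b - a))%:E = \int[mu]_(t in `[a, b]) K%:E)%E.
  rewrite integral_cst//= lebesgue_measure_itv/= lte_fin EFinM.
  by move: ab; rewrite le_eqVlt => /predU1P[->|->]; rewrite ?subrr ?ltxx// mule0.
have := @ge0_le_integral _ _ _ mu `[a, b]%classic (measurable_itv _)
  (fun t => rdist G (x t) (y t)) (cst K%:E).
apply => //.
- by move=> t _; exact: rdist_ge0.
- exact: measurable_rdist.
Qed.

Let sub1 (i : int) : (i + 1)%:~R - i%:~R = 1 :> R.
Proof. by rewrite intrD addrC addKr. Qed.

Let lei1 (i : int) : i%:~R <= (i + 1)%:~R :> R.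
Proof. by rewrite ler_int lerDl. Qed.

Lemma integral_dist_ge0 x y : (0 <= integral_dist G x y)%E.
Proof. by apply: esum_ge0 => i _; exact: wI_ge0. Qed.

(** The linear growth in [i] gives finiteness of the distance between two orbits; a bound constant
    in [i] fits too and gives the Lipschitz estimate for time shifts. *)
Lemma integral_dist_le x y (A : R) : 0 <= A -> continuous x -> continuous y ->
  (forall (i : int) (t : R), i%:~R <= t <= (i + 1)%:~R ->
    (rdist G (x t) (y t) <= (A * (`|i|%N%:R + 1))%:E)%E) ->
  (integral_dist G x y <= (8 * A)%:E)%E.
Proof.
move=> A0 cx cy H; apply: esum_int_weights => // i; rewrite wI_ge0/=.
rewrite mulrCA EFinM lee_pmul ?lee_fin//; first exact: I_ge0.
have K0 : 0 <= A * (`|i|%N%:R + 1) :> R by rewrite mulr_ge0// addr_ge0.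
have := integral_le (lei1 i) cx cy K0 (H i).
by rewrite sub1 mulr1.
Qed.

Lemma integral_dist_sym x y : integral_dist G x y = integral_dist G y x.
Proof.
apply: eq_esum => i _; congr (_ * _)%E; apply: eq_integral => t _.
exact: rdist_sym.
Qed.

Lemma integral_distxx x : integral_dist G x x = 0%E.
Proof.
apply: esum1 => i _; rewrite integral0_eq ?mule0// => t _.
exact: rdistxx.
Qed.

Lemma integral_dist_triangle x y z : continuous x -> continuous y ->
  continuous z ->
  (integral_dist G x z <= integral_dist G x y + integral_dist G y z)%E.
Proof.
move=> cx cy cz; rewrite /integral_dist -esumD//; try by move=> i _; exact: wI_ge0.
apply: le_esum => i _.
rewrite -ge0_muleDr; [|exact: I_ge0|exact: I_ge0].
apply: lee_pmul; [by rewrite lee_fin|exact: I_ge0|by []|].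
rewrite -ge0_integralD//; try exact: measurable_rdist; try by move=> t _; exact: rdist_ge0.
have m1 := measurable_rdist cx cz (measurable_itv `[i%:~R : R, (i + 1)%:~R : R]).
have m2 := measurable_rdist cx cy (measurable_itv `[i%:~R : R, (i + 1)%:~R : R]).
have m3 := measurable_rdist cy cz (measurable_itv `[i%:~R : R, (i + 1)%:~R : R]).
have m23 := emeasurable_funD m2 m3.
have r0 t : `[i%:~R : R, (i + 1)%:~R : R]%classic t -> (0 <= rdist G (x t) (z t))%E.
  by move=> _; exact: rdist_ge0.
have := @ge0_le_integral _ _ _ mu _ (measurable_itv _) _ _ r0 m1 m23; apply.
by move=> t _; exact: rdist_triangle.
Qed.

(** By continuity, a positive distance at [t0] stays above half its value on a short interval, which
    makes one of the integrals positive. *)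
Lemma integral_dist_eq0 x y : continuous x -> continuous y ->
  integral_dist G x y = 0%E -> x = y.
Proof.
move=> cx cy d0; apply/funext => t0; apply: (@rdist_eq0 _ _ _ G).
rewrite DE; congr EFin; apply/eqP; rewrite eq_le D_ge0 andbT leNgt; apply/negP => Dt0.
pose i : int := Num.floor t0.
(* The strict upper bound leaves room to the right of [t0] inside the same unit interval. *)
have it : i%:~R <= t0 < (i + 1)%:~R by rewrite floor_le floorD1_gt.
have /andP[it0 it1] := it.
have I0 : I x y i = 0%E.
  have : ((2 ^- `|i|%N : R)%:E * I x y i <= integral_dist G x y)%E.
    apply: esum_ge; exists [set i]; first by split=> //; exact: finite_set1.
    by rewrite fsbig_set1.
  rewrite d0 => h; apply/eqP; rewrite eq_le I_ge0 andbT leNgt; apply/negP => Ipos.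
  by move: h; rewrite leNgt mule_gt0// lte_fin invr_gt0 exprn_gt0.
have h2 : 0 < D x y t0 / 2 by rewrite divr_gt0.
have Dc : continuous (D x y) by exact: rdist_continuous.
have /cvgrPdist_lt/(_ _ h2)/nbhs_ballP[d /= d_gt0 Hd] := Dc t0.
pose b := Num.min (i + 1)%:~R (t0 + d / 2).
have tb : t0 < b by rewrite lt_min it1 ltrDl divr_gt0.
have : ((D x y t0 / 2 * (b - t0))%:E <= I x y i)%E.
  have -> : ((D x y t0 / 2 * (b - t0))%:E = \int[mu]_(t in `[t0, b]) (D x y t0 / 2)%:E)%E.
    by rewrite integral_cst//= lebesgue_measure_itv/= lte_fin EFinM tb.
  have m1 := measurable_rdist cx cy (measurable_itv `[t0, b]).
  have m2 := measurable_rdist cx cy (measurable_itv `[i%:~R : R, (i + 1)%:~R : R]).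
  have r0 t : `[t0, b]%classic t -> (0 <= (D x y t0 / 2)%:E)%E.
    by move=> _; rewrite lee_fin ltW.
  have m0 : measurable_fun `[t0, b] (fun=> (D x y t0 / 2)%:E) by exact: measurable_cst.
  have := @ge0_le_integral _ _ _ mu _ (measurable_itv _) _ _ r0 m0 m1.
  move=> /(_ _)/le_trans; apply.
  - move=> t /=; rewrite in_itv/= => /andP[t0t tb'].
    have td : ball t0 d t.
      have tb2 : t <= t0 + d / 2 by rewrite (le_trans tb')// ge_min lexx orbT.
      rewrite /ball/= ltr_distl ltrBlDr (le_lt_trans tb2)/=; last first.
        by rewrite ltrD2l ltr_pdivrMr// ltr_pMr// ltr1n.
      by rewrite (le_lt_trans t0t)// ltrDl.
    have : `|D x y t0 - D x y t| < D x y t0 / 2 by exact: Hd td.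
    rewrite ltr_distl => /andP[_ ht].
    by rewrite DE lee_fin -(lerD2r (D x y t0 / 2)) -splitr ltW.
  have := @ge0_subset_integral _ _ _ mu _ _ (measurable_itv `[t0, b]) (measurable_itv _) _ m2.
  apply.
    by move=> t _; exact: rdist_ge0.
  move=> t /=; rewrite !in_itv/= => /andP[t0t tb']; rewrite (le_trans it0 t0t)/=.
  by rewrite (le_trans tb')// ge_min lexx.
by rewrite I0 lee_fin leNgt mulr_gt0// subr_gt0.
Qed.

Let esum_shift (m : int) (a : int -> \bar R) :
  \esum_(i in [set: int]) a (i + m) = \esum_(i in [set: int]) a i.
Proof.
rewrite (@reindex_esum _ _ _ [set: int] [set: int] (fun i => i + m) a)//.
split=> //.
- by move=> i j _ _ /addIr.
- by move=> j _; exists (j - m) => //; rewrite subrK.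
Qed.

(** With [m] the floor of [t], the unit interval of index [i] shifted by [t] is covered by those of
    indices [i + m] and [i + m + 1]. Their weights compare with that of [i] up to the factors
    [2 ^ |m|] and [2 ^ |m + 1|]. *)
Lemma integral_dist_flow (t : R) x y : continuous x -> continuous y ->
  (integral_dist G (flow t x) (flow t y) <=
    (2 ^+ `|Num.floor t|%N + 2 ^+ `|(Num.floor t + 1)%R|%N)%:E * integral_dist G x y)%E.
Proof.
move=> cx cy; set m := Num.floor t.
have mt : m%:~R <= t by exact: floor_le.
have tm : t < (m + 1)%:~R by exact: floorD1_gt.
have shift i : (I (flow t x) (flow t y) i <= I x y (i + m) + I x y (i + m + 1))%E.
  have mD (S : set R) : measurable S -> measurable_fun S (fun t => rdist G (x t) (y t)).
    exact: measurable_rdist.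
  have <- : (\int[mu]_(u in `[(i%:~R + t)%R, ((i + 1)%:~R + t)%R]) rdist G (x u) (y u) =
      I (flow t x) (flow t y) i)%E.
    have := @ge0_integral_affine R 1 t `[i%:~R + t, (i + 1)%:~R + t]%classic _ (oner_neq0 _)
      (measurable_itv _) (mD _ (measurable_itv _)) (fun u _ => rdist_ge0 G (x u) (y u)).
    have E1 : [set u | `[i%:~R + t, (i + 1)%:~R + t]%classic (1 * u + t)] =
        `[i%:~R, (i + 1)%:~R]%classic.
      by apply/seteqP; split => u; rewrite /= !in_itv/= mul1r !lerD2r.
    rewrite normr1 mul1e E1.
    by move=> ->; apply: eq_integral => u _; rewrite mul1r addrC.
  pose U1 : set R := `[(i + m)%:~R : R, (i + m + 1)%:~R]%classic.
  (* Open on the left, so that the integral over the union splits; the endpoint is put back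
     afterwards. *)
  pose U2 : set R := `](i + m + 1)%:~R : R, (i + m + 1 + 1)%:~R]%classic.
  have E : `[i%:~R + t, (i + 1)%:~R + t]%classic `<=` U1 `|` U2.
    move=> u; rewrite /U1 /U2 /= !in_itv/= => /andP[iu ui].
    have h1 : (i + m)%:~R <= u by rewrite (le_trans _ iu)// intrD lerD2l.
    have h2 : u <= (i + m + 1 + 1)%:~R.
      rewrite (le_trans ui)// (_ : i + m + 1 + 1 = (i + 1) + (m + 1)); last by ring.
      by rewrite [leRHS]intrD lerD2l ltW.
    by have [h|h] := leP u (i + m + 1)%:~R; [left|right]; rewrite ?h1 ?h2.
  have mU1 : measurable U1 by exact: measurable_itv.
  have mU2 : measurable U2 by exact: measurable_itv.
  have mU := measurableU _ _ mU1 mU2.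
  have r0 (S : set R) u : S u -> (0 <= rdist G (x u) (y u))%E by move=> _; exact: rdist_ge0.
  have := @ge0_subset_integral _ _ _ mu _ _ (measurable_itv _) mU _ (mD _ mU) (@r0 _) E.
  move=> /le_trans; apply.
  have disj : [disjoint U1 & U2].
    rewrite disj_set2E; apply/eqP; rewrite -subset0 => u/= []; rewrite /U1 /U2 /= !in_itv/=.
    by move=> /andP[_ xt] /andP[]; rewrite ltNge xt.
  rewrite (@ge0_integral_setU _ _ _ mu _ _ mU1 mU2 _ (mD _ mU) (@r0 _) disj).
  apply: leeD => //.
  have mV : measurable `[(i + m + 1)%:~R : R, (i + m + 1 + 1)%:~R]%classic.
    exact: measurable_itv.
  apply: (@ge0_subset_integral _ _ _ mu _ _ mU2 mV _ (mD _ mV) (@r0 _)).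
  by move=> u; rewrite /U2 /= !in_itv/= => /andP[/ltW -> ->].
have w2 (i k : int) : 2 ^- `|i|%N <= 2 ^+ `|k|%N * 2 ^- `|(i + k)%R|%N :> R.
  rewrite ler_pdivlMr ?exprn_gt0// mulrC ler_pdivrMr ?exprn_gt0// -exprD.
  by rewrite ler_weXn2l ?ler1n//; lia.
have step k : (\esum_(i in [set: int]) ((2 ^- `|i|%N : R)%:E * I x y (i + k)) <=
    (2 ^+ `|k|%N)%:E * integral_dist G x y)%E.
  apply: le_trans (esum_le_scale _ (wI_ge0 x y)); last by rewrite exprn_ge0.
  rewrite -(esum_shift k (fun i => (2 ^+ `|k|%N)%:E * ((2 ^- `|i|%N)%:E * I x y i))%E).
  apply: le_esum => i _; rewrite muleA -EFinM.
  by apply: lee_pmul => //; rewrite lee_fin w2.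
rewrite EFinD ge0_muleDl ?lee_fin ?exprn_ge0//.
apply: le_trans (leeD (step m) (step (m + 1))).
rewrite -esumD; try by move=> i _; rewrite mule_ge0 ?lee_fin.
apply: le_esum => i _; rewrite -ge0_muleDr//.
rewrite (addrA i m 1); apply: lee_pmul; [by rewrite lee_fin|exact: I_ge0|by []|exact: shift].
Qed.

End lipschitz_curves.

(** * Time shifts of orbits and the conclusion *)

Lemma is_derive_translate (R : realType) (W : normedModType R) (f : R -> W)
    (t u : R) (v : W) : is_derive ((t + u : R) : R^o) (1 : R^o) f v ->
  is_derive (u : R^o) (1 : R^o) (fun s => f (t + s)) v.
Proof.
have E : (fun k : R => k^-1 *: (((fun s : R^o => f (t + s)) \o shift (u : R^o))
      (k *: (1 : R^o)) - f (t + u))) =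
    (fun k : R => k^-1 *: ((f \o shift ((t + u : R) : R^o)) (k *: (1 : R^o)) - f (t + u))).
  by apply/funext => k /=; rewrite addrCA.
by move=> [df fv]; apply: DeriveDef; rewrite ?/derivable ?/derive E.
Qed.

Section flow_of_orbits.
Context (R : realType) (n : nat) (M : manifold R n.+1).
Context (G : riemannian_metric M) (r : nat) (F : filippov_system M r).
Implicit Types (g : R -> M) (t : R).

Let has_velocity_flow t g u v :
  has_velocity g (t + u) v -> has_velocity (flow t g) u v.
Proof. exact: is_derive_translate. Qed.

Let shift_itv (t a b u : R) : a < u < b -> t + a < t + u < t + b.
Proof. by rewrite !ltrD2l. Qed.

Let plus_piece_flow t g a b :
  plus_piece F g (t + a) (t + b) -> plus_piece F (flow t g) a b.
Proof.
move=> H u uab; have [hp dv] := H _ (shift_itv t uab).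
by split=> //; exact: has_velocity_flow.
Qed.

Let minus_piece_flow t g a b :
  minus_piece F g (t + a) (t + b) -> minus_piece F (flow t g) a b.
Proof.
move=> H u uab; have [hp dv] := H _ (shift_itv t uab).
by split=> //; exact: has_velocity_flow.
Qed.

Let sliding_piece_flow t g a b :
  sliding_piece G F g (t + a) (t + b) -> sliding_piece G F (flow t g) a b.
Proof.
move=> H u uab; have [v sv dv] := H _ (shift_itv t uab).
by exists v => //; exact: has_velocity_flow.
Qed.

(** Maximality survives the shift because no interval properly contains the whole line; it remains
    to move the gluing times and the pieces by [-t]. *)
Lemma orbit_space_flow t g : orbit_space G F g -> orbit_space G F (flow t g).
Proof.
move=> [[_ _ gc [B [_ Bfin Bpiece Bglue]]] _]; split; last first.
  by move=> J k _ TJ _; apply/seteqP; split.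
split.
- by move=> a b _ _ c _.
- by exists 0, 1; split.
- have tc : continuous (fun s : R => t + s).
    by move=> s; apply: cvgD; [exact: cvg_cst|exact: cvg_id].
  exact: (within_continuous_compose gc tc (fun _ _ => I) (fun _ _ => erefl)).
exists [set u | B (t + u)]; split.
- by rewrite interiorT.
- move=> a b _ _.
  apply: (sub_finite_set _ (finite_image (fun x => x - t) (Bfin (t + a) (t + b) I I))).
  move=> u [/= Bu]; rewrite in_itv/= => uab.
  exists (t + u); last by rewrite addrC addKr.
  by split=> //=; rewrite in_itv/= !lerD2l.
- move=> a b ab H.
  have tab : t + a < t + b by rewrite ltrD2l.
  have [|K|K|K] := Bpiece _ _ tab.
  + move=> y /=; rewrite in_itv/= => /andP[ay yb]; split=> // By.
    have [|_] := H (y - t).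
      by rewrite /= in_itv/= ltrBrDl ltrBlDl ay yb.
    by apply; rewrite /= addrC subrK.
  + by apply: Or31; exact: plus_piece_flow.
  + by apply: Or32; exact: minus_piece_flow.
  + by apply: Or33; exact: sliding_piece_flow.
move=> u Bu; have [Su glue] := Bglue _ Bu; split=> // Sc.
have [e e0] := glue Sc; rewrite -[t + u - e]addrA -[t + u + e]addrA => K.
exists e => //; case: K => -[K1 K2]; [left|right]; split;
  by [exact: plus_piece_flow|exact: minus_piece_flow].
Qed.

End flow_of_orbits.

Unset Implicit Arguments.

Theorem theoremA (R : realType) (n : nat) (M : manifold R n.+1)
    (M_connected : connected [set: M]) (G : riemannian_metric M)
    (r : nat) (r_gt1 : (1 < r)%N) (F : filippov_system M r)
    (F_gt0 : (0 < Fnorm G F)%E)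
    (F_global : maximal_orbits_global G F)
    (F_bounded : bounded_system G F) :
  metric_on (orbit_space G F) (integral_dist G) /\
  continuous_flow_on (orbit_space G F) (integral_dist G) (@flow R n M).
Proof.
set C := field_bound G F.
have C0 : 0 <= C by exact: field_bound_ge0.
have orbc x : orbit_space G F x -> continuous x.
  by move=> /(orbit_velocity F_bounded)[].
have lip x : orbit_space G F x ->
    forall a b, (rdist G (x a) (x b) <= (C * `|b - a|)%:E)%E.
  move=> /(orbit_velocity F_bounded)[xc [B [Bfin xv]]] a b.
  exact: (rdist_lipschitz M_connected C0 xc Bfin xv).
have flowc t (x : R -> M) : continuous x -> continuous (flow t x).
  move=> xc s; apply: continuous_comp; last exact: xc.
  by apply: cvgD; [exact: cvg_cst|exact: cvg_id].
split; split.
- move=> x y Ax Ay; rewrite integral_dist_ge0/=.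
  (* Going through [x 0] and [y 0] costs at most [2 * C * |t|] more than their distance, and
     [|t| <= |i| + 1] on the unit interval of index [i]. *)
  pose A := fine (rdist G (x 0) (y 0)) + 2 * C.
  have d0 : 0 <= fine (rdist G (x 0) (y 0)) by exact/fine_ge0/rdist_ge0.
  have A0 : 0 <= A by rewrite addr_ge0// mulr_ge0.
  apply: (@le_lt_trans _ _ (8 * A)%:E); last exact: ltry.
  apply: integral_dist_le => //; [exact: orbc|exact: orbc|] => i t it.
  have ti : `|t| <= `|i|%N%:R + 1.
    have := it; rewrite natr_absz intr_norm intrD => /andP[it1 it2].
    have h1 := ler_norm (i%:~R : R); have h2 := ler_norm (- i%:~R : R).
    rewrite ler_norml; apply/andP; split.
      by move: h2; rewrite normrN; lra.
    by rewrite (le_trans it2)// lerD2r.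
  apply: (le_trans (rdist_triangle G (x t) (x 0) (y t))).
  apply: (le_trans (leeD (lip x Ax t 0) (rdist_triangle G (x 0) (y 0) (y t)))).
  apply: (le_trans (leeD (lexx _) (leeD (lexx _) (lip y Ay 0 t)))).
  rewrite (rdist_fineE G M_connected (x 0)) -!EFinD lee_fin sub0r normrN subr0.
  have Ct : C * `|t| <= C * (`|i|%N%:R + 1) by rewrite ler_wpM2l.
  have i0 : 0 <= `|i|%N%:R :> R by [].
  rewrite /A; set d := fine _ in d0 *; set k : R := `|i|%N%:R in i0 Ct *.
  have : 0 <= d * k by rewrite mulr_ge0.
  have -> : (d + 2 * C) * (k + 1) = d * k + d + (C * (k + 1) + C * (k + 1)) by ring.
  lra.
- move=> x y Ax Ay; split=> [|->]; last exact: integral_distxx.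
  by apply: integral_dist_eq0 => //; exact: orbc.
- by move=> x y _ _; exact: integral_dist_sym.
- by move=> x y z Ax Ay Az; apply: integral_dist_triangle => //; exact: orbc.
- by move=> t x; exact: orbit_space_flow.
- by move=> x _; apply/funext => s; rewrite /flow add0r.
- by move=> s t x _; apply/funext => u; rewrite /flow addrA [t + s]addrC.
move=> t x Ax e e0.
pose K : R := 2 ^+ `|Num.floor t|%N + 2 ^+ `|(Num.floor t + 1)%R|%N.
have K0 : 0 < K by rewrite addr_gt0 ?exprn_gt0.
have KC0 : 0 < K + 8 * C by rewrite ltr_wpDr// mulr_ge0.
(* The path from [flow t x] to [flow s y] goes through [flow t y]: the constant [K] then depends
   only on the fixed [t], and the change of time costs [8 * C * |s - t|] whatever [y] is. Together
   they use up exactly [e]. *)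
exists (e / (K + 8 * C)); first by rewrite divr_gt0.
move=> s y Ay st dxy; set e' := e / (K + 8 * C) in st dxy.
have xc := orbc _ Ax; have yc := orbc _ Ay.
have h1 : (integral_dist G (flow t x) (flow t y) < (K * e')%:E)%E.
  have hf := @integral_dist_flow _ _ _ G M_connected t _ _ xc yc.
  apply: (le_lt_trans hf).
  by rewrite EFinM lte_pmul2l.
have h2 : (integral_dist G (flow t y) (flow s y) <= (8 * C * e')%:E)%E.
  have Ce : 0 <= C * e' by rewrite mulr_ge0// ltW// (le_lt_trans _ st).
  rewrite -mulrA; apply: integral_dist_le => //; [exact: flowc|exact: flowc|] => i u _.
  apply: (le_trans (lip y Ay (t + u) (s + u))); rewrite lee_fin.
  rewrite (_ : s + u - (t + u) = s - t); last by ring.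
  rewrite (@le_trans _ _ (C * e'))//; first by rewrite ler_wpM2l// ltW.
  by rewrite ler_peMr// lerDr.
have := integral_dist_triangle G M_connected (flowc t _ xc) (flowc t _ yc) (flowc s _ yc).
move=> /le_lt_trans; apply.
have fin : integral_dist G (flow t y) (flow s y) \is a fin_num.
  by rewrite ge0_fin_numE ?integral_dist_ge0// (le_lt_trans h2)// ltry.
apply: (lt_le_trans (lte_leD fin h1 h2)).
by rewrite -EFinD lee_fin -mulrDl mulrC divfK// gt_eqF.
Qed.
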